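(* Let $\alpha=(\alpha_i)_{i\ge1}$ and $\beta=(\beta_i)_{i\ge1}$ be basic sequences, let $s=(s_i)_{i\ge1}$, $t=(t_i)_{i\ge1}$, $\upsilon=(\upsilon_i)_{i\ge1}$ be sequences of non-negative integers, and let $Q=Q(\alpha,\beta,s,t,\upsilon)$ be the basic sequence $$\left[[\alpha_1]^{s_1}[\beta_1]^{t_1}\right]^{\upsilon_1}\left[[\alpha_2]^{s_2}[\beta_2]^{t_2}\right]^{\upsilon_2}\left[[\alpha_3]^{s_3}[\beta_3]^{t_3}\right]^{\upsilon_3}\cdots .$$ Suppose that $Q$ is infinite in limit, that $\alpha_i=o(\beta_i)$ as $i\to\infty$, and that the following conditions hold: $$\lim_{n\to\infty}\frac{s_n\log\alpha_n}{\sum_{i=1}^{n-1}\upsilon_it_i\log\beta_i}=0,\qquad \lim_{n\to\infty}\frac{s_n\log\alpha_n}{t_n\log\beta_n}=0,$$ $$\lim_{n\to\infty}\frac{t_n\alpha_n^{m}}{s_n\beta_n^{m}}=0\ \text{ and }\ \lim_{n\to\infty}\frac{\alpha_n^{m}}{s_n}=0\quad\text{for every integer } m\ge1,$$ $$\lim_{n\to\infty}\frac{\sum_{i=1}^n\upsilon_is_i}{\sum_{i=1}^n\upsilon_i(s_i+t_i)}=0.$$ Then: (i) for every integer $k\ge1$, if $Q$ is $k$-divergent, then $\dim_{\mathrm H}\left(\left(\bigcap_{j=1}^k\mathscr{N}_j(Q)\right)\setminus\mathscr{DN}(Q)\right)=1$; (ii) if $Q$ is fully divergent, then $\dim_{\mathrm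 H}\left(\mathscr{N}(Q)\setminus\mathscr{DN}(Q)\right)=1$.
   Context: A basic sequence is a sequence $Q=(q_n)_{n=1}^\infty$ of integers with $q_n\ge 2$ for all $n$. It is infinite in limit if $q_n\to\infty$. The $Q$-Cantor series expansion of a real number $x$ is the unique expansion $x=E_0+\sum_{n=1}^\infty \frac{E_n}{q_1q_2\cdots q_n}$ with $E_0=\lfloor x\rfloor$, $E_n\in\{0,1,\ldots,q_n-1\}$ for $n\ge1$, and $E_n\ne q_n-1$ for infinitely many $n$. Notation for sequences: $[w]^m$ denotes the finite word $w$ repeated $m$ times and juxtaposition denotes concatenation; thus $Q(\alpha,\beta,s,t,\upsilon)$ consists, for $i=1,2,3,\ldots$ in order, of $\upsilon_i$ consecutive copies of the word formed by $s_i$ terms equal to $\alpha_i$ followed by $t_i$ terms equal to $\beta_i$. The limit conditions in the claim are understood to include that the denominators appearing are nonzero for all large $n$. Put $Q_n^{(k)}=\sum_{j=1}^n \frac{1}{q_jq_{j+1}\cdots q_{j+k-1}}$. $Q$ is $k$-divergent if $\lim_{n\to\infty}Q_n^{(k)}=\infty$, and fully divergent if it is $k$-divergent for all $k\ge1$. A block of length $k$ is an ordered $k$-tuple of non-negative integers. For a block $B$ of length $k$, $N_n^Q(B,x)$ denotes the number of indices $j$ with $1\le j\le n$ such that $(E_j,E_{j+1},\ldots,E_{j+k-1})=B$. Put $T_{Q,n}(x)=\left(\prod_{j=1}^n q_j\right)x \pmod 1$. - $\mathscr{N}_k(Q)$ ($k\ge1$) is the set of real $x$ such that $\lim_{n\to\infty}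 N_n^Q(B,x)/Q_n^{(k)}=1$ for all blocks $B$ of length $k$; $\mathscr{N}(Q)=\bigcap_{k\ge1}\mathscr{N}_k(Q)$. - $\mathscr{DN}(Q)$ is the set of real $x$ such that the sequence $(T_{Q,n}(x))_{n=0}^\infty$ is uniformly distributed mod $1$. $\dim_{\mathrm H}$ denotes Hausdorff dimension of subsets of $\mathbb{R}$. *)

(* Defs.v *)
From HB Require Import structures.
From mathcomp Require Import all_boot all_order all_algebra.
From mathcomp Require Import all_classical all_reals all_analysis.

Set Implicit Arguments.
Unset Strict Implicit.
Unset Printing Implicit Defensive.

Import Order.TTheory GRing.Theory Num.Theory.
Import numFieldNormedType.Exports.

Local Open Scope classical_set_scope.
Local Open Scope ring_scope.

(** All sequences are indexed from 1, as in the source: a term of index 0 is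
    never used, except for the integer part [E 0] of a Cantor expansion. *)

Definition basic_sequence (q : nat -> nat) : Prop :=
  forall n, (1 <= n)%N -> (2 <= q n)%N.

Definition infinite_in_limit (q : nat -> nat) : Prop :=
  q n @[n --> \oo] --> \oo.

(** The word [[alpha_i]^{s_i} [beta_i]^{t_i}]^{upsilon_i}, and the
    juxtaposition of those of index 1, ..., N. *)
Definition stage_word (alpha beta s t upsilon : nat -> nat) (i : nat) :
    seq nat :=
  flatten (nseq (upsilon i) (nseq (s i) (alpha i) ++ nseq (t i) (beta i))).

Definition stage_prefix (alpha beta s t upsilon : nat -> nat) (N : nat) :
    seq nat :=
  flatten [seq stage_word alpha beta s t upsilon i | i <- iota 1 N].

(** [q] is the infinite sequence Q(alpha, beta, s, t, upsilon).  The first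
    conjunct says that the juxtaposition of all the words is infinite, which
    can fail when the parameters vanish; the second one says that every finite
    juxtaposition is an initial segment of (q_1, q_2, ...). *)
Definition is_concatenation (alpha beta s t upsilon q : nat -> nat) : Prop :=
  (forall M, exists N,
     (M <= size (stage_prefix alpha beta s t upsilon N))%N) /\
  (forall N j, (j < size (stage_prefix alpha beta s t upsilon N))%N ->
     q j.+1 = nth 0%N (stage_prefix alpha beta s t upsilon N) j).

Section Cantor.
Context {R : realType}.
Implicit Types (q : nat -> nat) (x : R) (k n : nat).

(** a_n / b_n -> 0, with b_n != 0 for all large n; the first conjunct is
    needed because division by 0 yields 0. *)
Definition quotient_cvg0 (a b : nat -> R) : Prop :=
  (\forall n \near \oo, b n != 0) /\ (a n / b n @[n --> \oo] --> (0 : R)).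

Definition is_cantor_expansion q x (E : nat -> int) : Prop :=
  [/\ E 0%N = Num.floor x,
      forall n, (1 <= n)%N -> 0 <= E n <= (q n)%:Z - 1,
      infinite_set [set n | (1 <= n)%N /\ E n <> (q n)%:Z - 1] &
      ((E 0%N)%:~R +
        \sum_(1 <= i < n.+1) (E i)%:~R / \prod_(1 <= j < i.+1) (q j)%:R)
        @[n --> \oo] --> x].

(** Definite description: the expansion exists and is unique whenever [q] is a
    basic sequence. *)
Definition cantor_digits q x : nat -> int :=
  xget (fun=> 0) [set E | is_cantor_expansion q x E].

(** Q_n^(k) *)
Definition Qsum q k n : R :=
  \sum_(1 <= j < n.+1) (\prod_(j <= i < j + k) (q i)%:R)^-1.

Definition k_divergent q k : Prop := Qsum q k n @[n --> \oo] --> +oo.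

Definition fully_divergent q : Prop := forall k, (1 <= k)%N -> k_divergent q k.

(** N_n^Q(B, x); a block of length k is a k-tuple of natural numbers. *)
Definition block_count q k (B : k.-tuple nat) x n : nat :=
  count (fun j => [forall i : 'I_k,
                     cantor_digits q x (j + i)%N == (tnth B i)%:Z])
        (iota 1 n).

Definition normal_order q k : set R :=
  [set x | forall B : k.-tuple nat,
     (block_count q B x n)%:R / Qsum q k n @[n --> \oo] --> (1 : R)].

Definition normal_set q : set R :=
  \bigcap_(k in [set k | (1 <= k)%N]) normal_order q k.

Definition frac_part (y : R) : R := y - (Num.floor y)%:~R.

(** T_{Q,n}(x) *)
Definition cantor_orbit q n x : R :=
  frac_part ((\prod_(1 <= j < n.+1) (q j)%:R) * x).

Definition uniformly_distributed_mod1 (u : nat -> R) : Prop :=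
  forall a b : R, 0 <= a -> a < b -> b <= 1 ->
    (count (fun n => a <= frac_part (u n) < b) (iota 0 N))%:R / N%:R
      @[N --> \oo] --> b - a.

Definition distribution_normal q : set R :=
  [set x | uniformly_distributed_mod1 (fun n => cantor_orbit q n x)].

(** Hausdorff measure and dimension on the real line. *)

Definition diam (U : set R) : \bar R :=
  ereal_sup [set (`|x - y|)%:E | x in U & y in U].

(** The empty set contributes 0 for every exponent, including 0 (its diameter
    is -oo here); a nonempty set contributes diam(U)^d, with 0^0 = 1. *)
Definition diam_pow (d : R) (U : set R) : \bar R :=
  if U == set0 then 0%E else (diam U `^ d)%E.

Definition hausdorff_premeasure (d delta : R) (A : set R) : \bar R :=
  ereal_inf [set (\sum_(0 <= i <oo) diam_pow d (U i))%E |
    U in [set U : nat -> set R |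
      A `<=` \bigcup_i U i /\ forall i, (diam (U i) <= delta%:E)%E]].

Definition hausdorff_measure (d : R) (A : set R) : \bar R :=
  ereal_sup [set hausdorff_premeasure d delta A |
    delta in [set delta | 0 < delta]].

Definition hausdorff_dim (A : set R) : \bar R :=
  ereal_inf [set d%:E | d in [set d | 0 <= d /\ hausdorff_measure d A = 0%E]].

End Cantor.

Arguments k_divergent R q k : clear implicits.
Arguments fully_divergent R q : clear implicits.
Arguments normal_order R q k : clear implicits.
Arguments normal_set R q : clear implicits.
Arguments distribution_normal R q : clear implicits.

(* Main.v *)
(* At the beta-positions the digits are restricted to the upper half of
   [0, beta - 1), at the alpha-positions they are given by one explicit word.

   Dimension: the alpha-positions contribute a negligible proportion of
   log (q_1 ... q_n), and log (beta / 2) ~ log beta, so for every d < 1 there is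
   a map from [0, 1[ into the set of these numbers whose inverse is Hoelder of
   exponent d.

   Normality: at a beta-position no fixed block occurs (beta -> oo), and these
   positions contribute o(1) of the expected counts, since
   t / beta^k = o(s / alpha^k).  In the run of length s of a base alpha, the
   word contains every fixed block of length k in any initial segment of length
   n with the frequency n / alpha^k, up to an error O(1) + o(n / alpha^k), and
   s / alpha^k -> oo.

   Not distribution normal: the orbit is in [1/2, 1) at every beta-position, and
   along the ends of the stages the alpha-positions have density 0. *)
Require Import Defs.
From HB Require Import structures.
From mathcomp Require Import all_boot all_order all_algebra.
From mathcomp Require Import all_classical all_reals all_analysis.
From mathcomp Require Import ring lra zify.

Set Implicit Arguments.
Unset Strict Implicit.
Unset Printing Implicit Defensive.

Import Order.TTheory GRing.Theory Num.Theory.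
Import numFieldNormedType.Exports.

Local Open Scope classical_set_scope.
Local Open Scope ring_scope.

(** Normality counts only fixed blocks while the bases tend to infinity, so a run of base [b] needs
    no equidistribution: a block of length [k] is planted once every [b ^ k] letters, and the filler
    [b.-1] eventually exceeds every letter of a given block. The word does not depend on [k], so one
    set of points serves all orders, hence both claims. The obstacle is that averages are also taken
    inside a unit, and no hypothesis compares a new base directly with the weight accumulated so
    far. An error growing with [b] could not be absorbed there, so the count must be right on every
    initial segment of a run, up to a constant independent of [b] and a small multiple of the
    expected count. This is why the slots fill at most about b^(2/3) letters of a period and why the
    first period stays blank. A complete unit absorbs even the constant, as its weight tends to
    infinity. Halving the digit range at beta-positions serves twice: it keeps the orbit at or above
    1/2 there, and it prevents later digits from cancelling the first difference, which gives the
    Hoelder bound. *)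

Section HausdorffDimension.
Context {R : realType}.
Implicit Types (d delta c r : R) (A U : set R).

(** * Hausdorff dimension on the line: the upper bound 1 and a Hoelder criterion for the lower
    bound *)

Lemma diam_le U r : (forall x y, U x -> U y -> `|x - y| <= r) ->
  (diam U <= r%:E)%E.
Proof.
move=> Ur; apply: ge_ereal_sup => _ [x Ux [y Uy <-]].
by rewrite lee_fin; exact: Ur.
Qed.

Lemma le_diam U r x y : (diam U <= r%:E)%E -> U x -> U y -> `|x - y| <= r.
Proof.
move=> Ur Ux Uy; rewrite -lee_fin; apply: le_trans Ur.
by apply: ereal_sup_ubound; exists x => //; exists y.
Qed.

Lemma diam_pow_ge0 d U : (0 <= diam_pow d U)%E.
Proof. by rewrite /diam_pow; case: ifP => // _; exact: poweR_ge0. Qed.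

Lemma diam_ge0 U : U !=set0 -> (0 <= diam U)%E.
Proof.
move=> [x Ux]; rewrite (_ : 0%E = `|x - x|%:E); last by rewrite subrr normr0.
by apply: ereal_sup_ubound; exists x => //; exists x.
Qed.

Lemma diam_pow_le d U r : 0 <= d -> 0 <= r -> (diam U <= r%:E)%E ->
  (diam_pow d U <= (r `^ d)%:E)%E.
Proof.
move=> d0 r0 Ur; rewrite /diam_pow; case: ifPn => [_|/set0P U0].
  by rewrite lee_fin powR_ge0.
rewrite -poweR_EFin; apply: gt0_ler_poweR => //; rewrite in_itv/= leey andbT //.
exact: diam_ge0.
Qed.

(** Dyadic condensation: the block of indices from [2 ^ g] up to [2 ^ g.+1] contributes at most
    [r ^+ g], where r = 2^(1-d) < 1. *)
Lemma sum_riemannR_le d : 1 < d -> exists2 K : R, 0 < K &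
  forall m, \sum_(0 <= n < m) (n.+1%:R `^ d)^-1 <= K.
Proof.
move=> d1.
pose r : R := 2 `^ (1 - d).
have r0 : 0 < r by exact: powR_gt0.
have r1 : r < 1.
  by rewrite /r /powR pnatr_eq0/= expR_lt1 pmulr_llt0 ?ln_gt0 ?ltr1n//; lra.
have term_ge0 n : 0 <= (n.+1%:R `^ d)^-1 :> R by rewrite invr_ge0 powR_ge0.
have block g : \sum_((2 ^ g)%N <= n < (2 ^ g.+1)%N) (n.+1%:R `^ d)^-1 <= r ^+ g.
  apply: (@le_trans _ _ (\sum_((2 ^ g)%N <= n < (2 ^ g.+1)%N) ((2 ^+ g : R) `^ d)^-1)).
    apply: ler_sum_nat => n /andP[gn _].
    rewrite lef_pV2 ?posrE ?powR_gt0 ?exprn_gt0//.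
    apply: ge0_ler_powR; rewrite ?nnegrE ?exprn_ge0//; first lra.
    by rewrite -natrX ler_nat; exact: leq_trans gn _.
  rewrite big_const_nat iter_addr addr0.
  have -> : (2 ^ g.+1 - 2 ^ g = 2 ^ g)%N by rewrite expnS mul2n -addnn addnK.
  rewrite -[_ *+ _]mulr_natr natrX -powR_mulrn// -[r ^+ g]powR_mulrn ?powR_ge0//.
  rewrite -!powRrM -powRN -powRD; last by rewrite pnatr_eq0 implybT.
  by rewrite le_eqVlt; apply/orP; left; apply/eqP; congr (_ `^ _); ring.
have dyadic g : \sum_(0 <= n < (2 ^ g)%N) (n.+1%:R `^ d)^-1 <=
    1 + \sum_(0 <= h < g) r ^+ h.
  elim: g => [|g IH]; first by rewrite big_nat1 powR1 invr1 big_geq ?addr0.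
  rewrite (@big_cat_nat _ _ _ (2 ^ g)%N)//=; last by rewrite leq_exp2l.
  by rewrite big_nat_recr//= addrA; exact: lerD.
exists (1 + (1 - r)^-1); first by rewrite addr_gt0// invr_gt0 subr_gt0.
move=> m; apply: (@le_trans _ _ (\sum_(0 <= n < (2 ^ m)%N) (n.+1%:R `^ d)^-1)).
  rewrite [leRHS](@big_cat_nat _ _ _ m)//=; last exact/ltnW/ltn_expl.
  by rewrite lerDl sumr_ge0.
apply: le_trans (dyadic m) _; rewrite lerD2l.
have := geometric_seriesE 1 (negbT (lt_eqF r1)).
move=> /(congr1 (fun f => f m)); rewrite /series/= => E.
under eq_bigr => i _ do rewrite -[_ ^+ _]mul1r.
rewrite E mul1r ler_pdivrMr ?subr_gt0// mulVf ?subr_eq0 ?gt_eqF//.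
by rewrite lerBlDr lerDl exprn_ge0// ltW.
Qed.

Lemma harmonic_unbounded (x : R) : exists n, x < series harmonic n.
Proof.
apply: contrapT => /forallNP H.
apply: (@dvg_harmonic R).
apply: nondecreasing_is_cvgn.
  by apply/nondecreasing_seqP => n; rewrite !seriesEnat/= big_nat_recr//= lerDl.
by exists x => _ [n _ <-]; rewrite leNgt; apply/negP/H.
Qed.

(* The intervals of length [c / k], laid end to end from 0 in both directions,
   cover the line, while the sum of [(c / k)^d] converges. *)
Lemma hausdorff_measure_gt1 d A : 1 < d -> hausdorff_measure d A = 0%E.
Proof.
move=> d1; have [K K0 sumK] := sum_riemannR_le d1.
have d0 : 0 <= d by lra.
have pre_ge0 delta : (0 <= hausdorff_premeasure d delta A)%E.
  apply: le_ereal_inf_tmp => _ [U _ <-].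
  by apply: nneseries_ge0 => n _ _; exact: diam_pow_ge0.
apply/eqP; rewrite eq_le; apply/andP; split; last first.
  apply: le_trans (pre_ge0 1) _.
  by apply: ereal_sup_ubound; exists 1 => //=.
apply: ge_ereal_sup => _ [delta /= delta0 <-].
apply/lee_addgt0Pr => e e0; rewrite add0e.
(* The factor 2 pays for using each length on both sides of 0: the [n]-th interval has length c /
   (n/2 + 1) with integer quotient, at most 2c / (n + 1). *)
pose c : R := Num.min delta ((e / K) `^ d^-1 / 2).
have c0 : 0 < c.
  by rewrite /c lt_min delta0/= divr_gt0// powR_gt0// divr_gt0.
have cd : (2 * c) `^ d <= e / K.
  have eK : 0 <= e / K by rewrite divr_ge0// ltW.
  apply: (@le_trans _ _ (((e / K) `^ d^-1) `^ d)).
    apply: ge0_ler_powR; rewrite ?nnegrE ?powR_ge0//.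
      by rewrite mulr_ge0// ltW.
    by rewrite mulrC -ler_pdivlMr// /c ge_min lexx orbT.
  by rewrite -powRrM mulVf ?powRr1//; lra.
pose H : nat -> R := series harmonic.
have HS k : H k.+1 = H k + k.+1%:R^-1.
  by rewrite /H !seriesEnat/= big_nat_recr.
pose I k : set R := [set x | c * H k <= x <= c * H k.+1].
pose V n : set R := if odd n then [set x | I n./2 (- x)] else I n./2.
have Vdiam n : (diam (V n) <= (c / n./2.+1%:R)%:E)%E.
  apply: diam_le => x y; rewrite /V /I; case: (odd n) => /=;
    rewrite HS mulrDr; move: (c * _) (c / _) => u v /andP[? ?] /andP[? ?];
    rewrite ler_norml; apply/andP; split; lra.
have cle n : c / n.+1%:R <= c.
  by rewrite ler_pdivrMr ?ltr0Sn// ler_peMr ?ler1n// ltW.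
have Vcover x : exists n, V n x.
  have [n xn] := harmonic_unbounded (`|x| / c).
  have := ex_minnP (ex_intro (fun m => `|x| / c < H m) n xn) => -[m xm mmin].
  case: m xm mmin => [|m] xm mmin.
    by move: xm; rewrite /H seriesEnat/= big_geq// ltNge divr_ge0// ltW.
  have Hm : c * H m <= `|x| <= c * H m.+1.
    rewrite [in X in _ && X]mulrC -ler_pdivrMr// (ltW xm) andbT.
    rewrite mulrC -ler_pdivlMr// leNgt; apply/negP => /mmin.
    by rewrite ltnn.
  have [x0|x0] := leP 0 x.
    by exists m.*2; rewrite /V odd_double doubleK /I/= -(ger0_norm x0).
  by exists m.*2.+1; rewrite /V/= odd_double/= uphalf_double /I/= -(ltr0_norm x0).
apply: ge_ereal_inf; exists (\sum_(0 <= i <oo) diam_pow d (V i))%E.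
  exists V => //; split=> [x _|n]; first by have [n] := Vcover x; exists n.
  apply: le_trans (Vdiam n) _; rewrite lee_fin; apply: le_trans (cle _) _.
  by rewrite /c ge_min lexx.
apply: lime_le; first by apply: is_cvg_nneseries => n _ _; exact: diam_pow_ge0.
apply: nearW => m.
apply: (@le_trans _ _ (\sum_(0 <= n < m) (e / K * (n.+1%:R `^ d)^-1)%:E)%E).
  apply: lee_sum => n _; apply: le_trans (diam_pow_le d0 _ (Vdiam n)) _.
    by rewrite divr_ge0// ltW.
  rewrite lee_fin; apply: (@le_trans _ _ ((2 * c / n.+1%:R) `^ d)).
    have c2 : 0 <= c by exact: ltW.
    apply: ge0_ler_powR; rewrite ?nnegrE ?divr_ge0 ?mulr_ge0//.
    rewrite ler_pdivlMr ?ltr0Sn// mulrAC ler_pdivrMr ?ltr0Sn//.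
    rewrite [leRHS]mulrAC [leRHS]mulrC ler_pM2l// -natrM ler_nat.
    by have := odd_double_half n; lia.
  rewrite powRM ?invr_ge0//; last by rewrite mulr_ge0// ltW.
  rewrite -[X in _ * X `^ _]powR_inv1// -powRrM mulN1r powRN.
  by rewrite ler_wpM2r// invr_ge0 powR_ge0.
rewrite sumEFin lee_fin -mulr_sumr mulrAC ler_pdivrMr//.
by rewrite ler_pM2l.
Qed.

Lemma hausdorff_dim_le1 A : (hausdorff_dim A <= 1%:E)%E.
Proof.
apply/lee_addgt0Pr => e e0; apply: ge_ereal_inf.
exists (1 + e)%:E; last by rewrite EFinD.
exists (1 + e) => //; split; [lra|apply: hausdorff_measure_gt1; lra].
Qed.

(* A cover of [A] pulls back along [G] to a cover of [0, 1[ by sets of diameter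
   at most [C diam(U_i)^d], so the subadditivity of Lebesgue measure bounds the
   sum of the [diam(U_i)^d] from below. *)
Lemma hausdorff_dim_ge1 A :
  (forall d, 0 < d < 1 -> exists2 C, 0 < C & exists G : R -> R,
     forall y, 0 <= y < 1 -> A (G y) /\
       (forall z, 0 <= z < 1 -> `|y - z| <= C * `|G y - G z| `^ d)) ->
  (1%:E <= hausdorff_dim A)%E.
Proof.
move=> AH; apply: le_ereal_inf_tmp => _ [d [d0 dA] <-]; rewrite lee_fin leNgt.
(* [d] may be 0, which the hypothesis excludes; passing to a larger exponent below 1 is harmless for
   sets of diameter at most 1. *)
apply/negP => d1; pose d' := (d + 1) / 2.
have d'01 : 0 < d' < 1 by rewrite /d'; lra.
have d'0 : 0 <= d' by lra.
have [C C0 [G GP]] := AH _ d'01.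
(* The pulled back intervals have length 2C diam^d, so this bound makes their total length less than
   1/2, too little to cover the unit interval. *)
have : (hausdorff_premeasure d 1 A < (4 * C)^-1%:E)%E.
  apply: (@le_lt_trans _ _ 0%E); last by rewrite lte_fin invr_gt0 mulr_gt0.
  by rewrite -dA; apply: ereal_sup_ubound; exists 1 => //=.
move=> /ereal_inf_lt[_ [U [AU Udiam] <-]] Usum.
have Vball n : exists x : R, forall y, 0 <= y < 1 -> U n (G y) ->
    `|x - y| <= C * fine (diam_pow d (U n)).
  have [[y [y01 Uy]]|noy] := pselect (exists y, 0 <= y < 1 /\ U n (G y)); last first.
    by exists 0 => y y01 Uy; case: noy; exists y.
  exists y => z z01 Uz; have [_ /(_ _ z01)] := GP _ y01.
  move=> /le_trans; apply; rewrite ler_pM2l//.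
  have Un0 : U n !=set0 by exists (G y).
  have /fineK : diam (U n) \is a fin_num.
    rewrite ge0_fin_numE ?diam_ge0//; apply: le_lt_trans (Udiam n) _.
    by rewrite ltry.
  set r := fine _ => rE.
  have r0 : 0 <= r by rewrite -lee_fin rE diam_ge0.
  have r1 : r <= 1 by rewrite -lee_fin rE.
  rewrite /diam_pow ifF; last by apply/negbTE/set0P.
  rewrite -rE poweR_EFin/=.
  apply: (@le_trans _ _ (r `^ d')).
    apply: ge0_ler_powR; rewrite ?nnegrE//.
    by apply: (@le_diam (U n)) => //; rewrite rE.
  have [->|rn0] := eqVneq r 0.
    by rewrite powR0 ?powR_ge0//; lra.
  apply: ger_powR; first by rewrite r1 andbT lt_neqAle eq_sym rn0.
  by rewrite /d'; lra.
have [x xP] := choice Vball.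
have fin n : diam_pow d (U n) \is a fin_num.
  rewrite ge0_fin_numE ?diam_pow_ge0//.
  by apply: le_lt_trans (diam_pow_le d0 ler01 (Udiam n)) _; rewrite ltry.
pose w n := C * fine (diam_pow d (U n)).
have w0 n : 0 <= w n by rewrite mulr_ge0 ?fine_ge0 ?diam_pow_ge0// ltW.
pose F n : set R := `[x n - w n, x n + w n]%classic.
have cover : `[0, 1[%classic `<=` \bigcup_n F n.
  move=> y; rewrite /= in_itv/= => y01; have [/AU[n _ Un] _] := GP _ y01.
  exists n => //; rewrite /F/= in_itv/=.
  by have := xP n _ y01 Un; rewrite -/(w n) ler_norml => /andP[? ?]; lra.
have : (lebesgue_measure (`[0%R, 1%R[%classic : set R) <=
    \sum_(0 <= n <oo) lebesgue_measure (F n))%E.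
  by apply: measure_sigma_subadditive => // n; exact: measurable_itv.
rewrite lebesgue_measure_itv/= lte_fin ltr01 oppr0 adde0.
apply/negP; rewrite -ltNge.
apply: (@le_lt_trans _ _ (\sum_(0 <= n <oo) (2 * C)%:E * diam_pow d (U n))%E).
  apply: lee_nneseries => // n _.
  rewrite lebesgue_measure_itv/=; case: ifP => _.
    rewrite -EFinB -(fineK (fin n)) -EFinM lee_fin /w; lra.
  by rewrite mule_ge0 ?diam_pow_ge0// lee_fin mulr_ge0// ltW.
rewrite nneseriesZl; last by move=> n _; exact: diam_pow_ge0.
apply: (@lt_trans _ _ ((2 * C)%:E * (4 * C)^-1%:E)%E).
  by rewrite lte_pmul2l// lte_fin mulr_gt0.
rewrite -EFinM lte_fin invfM mulrACA divff; last by rewrite gt_eqF.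
by lra.
Qed.

End HausdorffDimension.

(** * Cantor expansions as nested intervals *)

Section CantorExpansion.
Context {R : realType}.
Implicit Types (q : nat -> nat) (x : R) (E : nat -> int).

Definition qprod q n : R := \prod_(1 <= j < n.+1) (q j)%:R.

Lemma qprod0 q : qprod q 0 = 1.
Proof. by rewrite /qprod big_geq. Qed.

Lemma qprodS q n : qprod q n.+1 = qprod q n * (q n.+1)%:R.
Proof. by rewrite /qprod big_nat_recr. Qed.

Lemma qprod_gt0 q n : (forall j, (1 <= j)%N -> (1 <= q j)%N) -> 0 < qprod q n.
Proof.
move=> q1; elim: n => [|n IH]; first by rewrite qprod0.
by rewrite qprodS mulr_gt0// ltr0n q1.
Qed.

Lemma le_qprod p q n : (forall j, (1 <= j)%N -> (p j <= q j)%N) ->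
  qprod p n <= qprod q n.
Proof.
move=> pq; elim: n => [|n IH]; first by rewrite !qprod0.
by rewrite !qprodS ler_pM ?ler_nat ?pq ?prodr_ge0.
Qed.

Lemma qprod_nondecreasing q : (forall j, (1 <= j)%N -> (1 <= q j)%N) ->
  {homo qprod q : m n / (m <= n)%N >-> m <= n}.
Proof.
move=> q1; apply/nondecreasing_seqP => n.
by rewrite qprodS ler_peMr ?ler1n ?q1// ltW// qprod_gt0.
Qed.

(* The sum of the first [n] terms of the expansion, multiplied by
   [q 1 * ... * q n]. *)
Fixpoint cantor_num q E n : int :=
  if n is n'.+1 then cantor_num q E n' * (q n)%:Z + E n else E 0%N.

Lemma cantor_num_sum q E n : (forall j, (1 <= j)%N -> (1 <= q j)%N) ->
  (E 0%N)%:~R + \sum_(1 <= i < n.+1) (E i)%:~R / \prod_(1 <= j < i.+1) (q j)%:R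
  = (cantor_num q E n)%:~R / qprod q n :> R.
Proof.
move=> q1; elim: n => [|n IH]; first by rewrite big_geq// addr0 qprod0 divr1.
rewrite big_nat_recr//= addrA IH -/(qprod q n.+1) qprodS rmorphD rmorphM/=.
have := qprod_gt0 n q1; have : (0 : R) < (q n.+1)%:R by rewrite ltr0n q1.
by move=> *; field; rewrite !gt_eqF.
Qed.

Lemma cantor_num_cvg q E x : (forall j, (1 <= j)%N -> (1 <= q j)%N) ->
  ((E 0%N)%:~R + \sum_(1 <= i < n.+1)
      (E i)%:~R / \prod_(1 <= j < i.+1) (q j)%:R @[n --> \oo] --> x) <->
  ((cantor_num q E n)%:~R / qprod q n @[n --> \oo] --> x).
Proof.
move=> q1; split; apply: cvg_trans; apply: near_eq_cvg; apply: nearW => n;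
  by rewrite cantor_num_sum.
Qed.

Section Bounds.
Variables (q : nat -> nat) (E : nat -> int).
Hypothesis q1 : forall j, (1 <= j)%N -> (1 <= q j)%N.
Hypothesis Eq : forall n, (1 <= n)%N -> 0 <= E n <= (q n)%:Z - 1.

Let low n : R := (cantor_num q E n)%:~R / qprod q n.
Let up n : R := (cantor_num q E n + 1)%:~R / qprod q n.

Let lowS n : low n.+1 = low n + (E n.+1)%:~R / qprod q n.+1.
Proof.
rewrite /low qprodS/= rmorphD rmorphM/=.
have := qprod_gt0 n q1; have : (0 : R) < (q n.+1)%:R by rewrite ltr0n q1.
by move=> *; field; rewrite !gt_eqF.
Qed.

Let upS n : up n.+1 = up n - ((q n.+1)%:Z - 1 - E n.+1)%:~R / qprod q n.+1.
Proof.
rewrite /up qprodS/= !(rmorphD, rmorphM, rmorphN)/=.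
have := qprod_gt0 n q1; have : (0 : R) < (q n.+1)%:R by rewrite ltr0n q1.
by move=> *; field; rewrite !gt_eqF.
Qed.

Lemma cantor_low_nondecreasing : {homo low : m n / (m <= n)%N >-> m <= n}.
Proof.
apply/nondecreasing_seqP => n; rewrite lowS lerDl.
by rewrite divr_ge0 ?ler0z ?(ltW (qprod_gt0 _ _))//; case/andP: (Eq (ltn0Sn n)).
Qed.

Lemma cantor_up_nonincreasing : {homo up : m n / (m <= n)%N >-> m >= n}.
Proof.
apply/nonincreasing_seqP => n; rewrite upS lerBlDr lerDl.
rewrite divr_ge0 ?(ltW (qprod_gt0 _ _))// ler0z subr_ge0.
by case/andP: (Eq (ltn0Sn n)).
Qed.

Lemma cantor_low_le_up m n : low m <= up n.
Proof.
apply: (@le_trans _ _ (low (maxn m n))).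
  by apply: cantor_low_nondecreasing; rewrite leq_maxl.
apply: (@le_trans _ _ (up (maxn m n))).
  by rewrite ler_pM2r ?invr_gt0 ?qprod_gt0// ler_int; lia.
by apply: cantor_up_nonincreasing; rewrite leq_maxr.
Qed.

(** The upper bound is strict because [up] drops strictly at some index after [n], namely where a
    digit differs from [q m - 1]. *)
Lemma cantor_floor x :
  infinite_set [set n | (1 <= n)%N /\ E n <> (q n)%:Z - 1] ->
  low n @[n --> \oo] --> x -> forall n, low n <= x < up n.
Proof.
move=> infE lowx n; have xE : x = limn low by apply/esym/cvg_lim.
have lowcvg : cvgn low by apply/cvg_ex; exists x.
apply/andP; split.
  by rewrite xE; apply: nondecreasing_cvgn_le => //; exact: cantor_low_nondecreasing.
have [m nm [m1 Em]] : exists2 m, (n < m)%N & (1 <= m)%N /\ E m <> (q m)%:Z - 1.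
  apply: contrapT => H; apply: infE; apply: (sub_finite_set _ (finite_II n.+1)).
  move=> m /= mE; rewrite ltnNge; apply/negP => nm; apply: H; exists m => //.
case: m nm m1 Em => // m nm _ Em.
have xup : x <= up m.+1.
  by rewrite xE; apply: limr_le => //; apply: nearW => k; exact: cantor_low_le_up.
apply: le_lt_trans xup _; apply: (@lt_le_trans _ _ (up m)); last first.
  exact: cantor_up_nonincreasing.
rewrite upS gtrBl divr_gt0 ?qprod_gt0// ltr0z subr_gt0 lt_neqAle.
by case/andP: (Eq (ltn0Sn m)) => _ ->; rewrite andbT; apply/eqP.
Qed.

Lemma cantor_low_cvg : exists x, low n @[n --> \oo] --> x.
Proof.
apply/cvg_ex; apply: nondecreasing_is_cvgn; first exact: cantor_low_nondecreasing.
by exists (up 0) => _ [n _ <-]; exact: cantor_low_le_up.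
Qed.

End Bounds.

(** Scaled by [qprod q n], the interval of [cantor_floor] has consecutive integers as ends. Hence
    [x] determines every numerator, and by the recursion every digit. *)
Lemma cantor_expansion_floor q x E : (forall j, (1 <= j)%N -> (1 <= q j)%N) ->
  is_cantor_expansion q x E ->
  forall n, cantor_num q E n = Num.floor (qprod q n * x).
Proof.
move=> q1 [E0 Eq infE sumE] n; apply/esym/floor_def.
have : (cantor_num q E n)%:~R / qprod q n <= x < (cantor_num q E n + 1)%:~R / qprod q n.
  by apply: cantor_floor => //; apply/cantor_num_cvg.
by rewrite ler_pdivrMr ?qprod_gt0// ltr_pdivlMr ?qprod_gt0// ![x * _]mulrC.
Qed.

Lemma cantor_expansion_unique q x E F : (forall j, (1 <= j)%N -> (1 <= q j)%N) ->
  is_cantor_expansion q x E -> is_cantor_expansion q x F -> E = F.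
Proof.
move=> q1 HE HF; have numE n : cantor_num q E n = cantor_num q F n.
  by rewrite !(@cantor_expansion_floor q x).
apply/funext => -[|n]; first exact: (numE 0%N).
by have := numE n.+1; rewrite /= numE => /addrI.
Qed.

Lemma cantor_digitsE q x E : (forall j, (1 <= j)%N -> (1 <= q j)%N) ->
  is_cantor_expansion q x E -> cantor_digits q x = E.
Proof.
move=> q1 HE; rewrite /cantor_digits; case: xgetP => [F _ /= HF|/(_ E)/=//].
exact: (@cantor_expansion_unique q x).
Qed.

(* [T_{Q,n}(x)] is the number with digits E_{n+1}, E_{n+2}, ... *)
Lemma cantor_orbit_ge q x E n : (forall j, (1 <= j)%N -> (1 <= q j)%N) ->
  is_cantor_expansion q x E ->
  (E n.+1)%:~R / (q n.+1)%:R <= cantor_orbit q n x.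
Proof.
move=> q1 HE; rewrite /cantor_orbit /frac_part -/(qprod q n).
rewrite -(cantor_expansion_floor q1 HE).
have := cantor_expansion_floor q1 HE n.+1.
move=> /(congr1 (fun z : int => z%:~R : R)) /= numE.
have : (cantor_num q E n.+1)%:~R <= qprod q n.+1 * x by rewrite numE floor_le.
rewrite /= qprodS rmorphD rmorphM/= mulrAC.
have qn : 0 < (q n.+1)%:R :> R by rewrite ltr0n q1.
by move=> H; rewrite ler_pdivrMr// mulrBl lerBrDl.
Qed.

Lemma frac_part_id (y : R) : 0 <= y < 1 -> frac_part y = y.
Proof.
by move=> y01; rewrite /frac_part (@floor_def _ _ 0) ?subr0// add0r.
Qed.

Lemma frac_part_itv (y : R) : 0 <= frac_part y < 1.
Proof.
rewrite /frac_part subr_ge0 floor_le ltrBlDl /=.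
by have := floorD1_gt y; rewrite rmorphD.
Qed.

End CantorExpansion.

(** * Numbers with digits in prescribed ranges, and the Hoelder bound for their parametrization *)

(* [cantor_point y] is the number whose digits in base [q] are those of [y] in
   base [N], the [j]-th one being shifted by [lo j]. *)
Section HomogeneousCantorSet.
Context {R : realType}.
Variables (q lo N : nat -> nat).
Hypothesis N_gt0 : forall j, (1 <= j)%N -> (1 <= N j)%N.
Hypothesis loN_le : forall j, (1 <= j)%N -> (lo j + N j <= q j)%N.
Hypothesis N_half : forall j, (1 <= j)%N -> ((N j).*2 <= (q j).+1)%N.
Hypothesis loN_lt : infinite_set [set j | (1 <= j)%N /\ (lo j + N j < q j)%N].
Hypothesis N_unbounded : forall x : R, exists n, x < qprod N n.

Let q_gt0 j : (1 <= j)%N -> (1 <= q j)%N.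
Proof. by move=> j1; have := N_gt0 j1; have := loN_le j1; lia. Qed.

Definition cantor_index (y : R) n : nat := Num.truncn (qprod N n * y).

Definition cantor_choice (y : R) n : int :=
  if n is 0%N then 0 else (lo n + cantor_index y n %% N n)%N.

(** Truncation commutes with division by the integer [N n.+1], so the quotient of the next index is
    the current one; the remainders are the digits of [y] in base [N]. *)
Lemma cantor_indexS y n : 0 <= y -> cantor_index y n.+1 =
  (cantor_index y n * N n.+1 + cantor_index y n.+1 %% N n.+1)%N.
Proof.
move=> y0; rewrite {1}(divn_eq (cantor_index y n.+1) (N n.+1)); congr (_ * _ + _)%N.
have Nn : (0 < N n.+1)%N by exact: N_gt0.
have PN := qprod_gt0 (R := R) n N_gt0.
apply/esym/truncn_def; set z := qprod N n * y.
have z0 : 0 <= z by rewrite mulr_ge0// ltW.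
have /truncn_itv : 0 <= z * (N n.+1)%:R by rewrite mulr_ge0.
rewrite /cantor_index (_ : qprod N n.+1 * y = z * (N n.+1)%:R); last first.
  by rewrite qprodS mulrAC.
set k := Num.truncn _ => /andP[k1 k2].
have Nn' : 0 < (N n.+1)%:R :> R by rewrite ltr0n.
apply/andP; split.
  rewrite -(ler_pM2r Nn') -natrM; apply: le_trans k1.
  by rewrite ler_nat leq_divM.
rewrite -(ltr_pM2r Nn') -natrM; apply: lt_le_trans k2 _.
by rewrite ler_nat; exact: ltn_ceil.
Qed.

Lemma cantor_index_mod_lt y n : (1 <= n)%N -> (cantor_index y n %% N n < N n)%N.
Proof. by move=> n1; rewrite ltn_mod; exact: N_gt0. Qed.

Lemma cantor_choice_itv y n : (1 <= n)%N -> 0 <= cantor_choice y n <= (q n)%:Z - 1.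
Proof.
case: n => // n n1; have := cantor_index_mod_lt y n1; have := loN_le n1.
by rewrite /cantor_choice; lia.
Qed.

Lemma cantor_choice_inf y :
  infinite_set [set n | (1 <= n)%N /\ cantor_choice y n <> (q n)%:Z - 1].
Proof.
apply: contra_not loN_lt; apply: sub_finite_set => -[|n] /= [n1 lt] //; split => //.
by have := cantor_index_mod_lt y n1; lia.
Qed.

Lemma cantor_point_exists y : exists x : R,
  is_cantor_expansion q x (cantor_choice y).
Proof.
have [x xlim] := cantor_low_cvg (R := R) q_gt0 (@cantor_choice_itv y).
exists x; split.
- apply/esym/floor_def.
  have := cantor_floor q_gt0 (@cantor_choice_itv y) (@cantor_choice_inf y) xlim 0%N.
  by rewrite /= qprod0 !divr1.
- exact: cantor_choice_itv.
- exact: cantor_choice_inf.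
- exact/cantor_num_cvg.
Qed.

Definition cantor_point y : R := projT1 (cid (cantor_point_exists y)).

Lemma cantor_pointP y : is_cantor_expansion q (cantor_point y) (cantor_choice y).
Proof. exact: projT2 (cid (cantor_point_exists y)). Qed.

(* By [N_half], the contributions of the digits after the first difference
   amount to at most half a unit of the digit where it occurs. *)
Lemma cantor_point_gap y z n :
  (forall m, (m <= n)%N -> cantor_choice y m = cantor_choice z m) ->
  (cantor_choice y n.+1 < cantor_choice z n.+1)%R ->
  (cantor_choice z n.+1 - cantor_choice y n.+1)%:~R / (2 * qprod q n.+1)
    <= cantor_point z - cantor_point y.
Proof.
move=> eq_le lt_n; set D := cantor_choice z n.+1 - _.
pose num := cantor_num q.
have numS E m : num E m.+1 = num E m * (q m.+1)%:Z + E m.+1 by [].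
have num_n : num (cantor_choice y) n = num (cantor_choice z) n.
  elim: n eq_le {lt_n D} => [|n IH] eq_le; first exact: eq_le.
  by rewrite !numS IH ?eq_le// => m mn; apply: eq_le; exact: leqW.
pose diff m : R := (num (cantor_choice z) m - num (cantor_choice y) m)%:~R.
(* The quotient never decreases: by [N_half] a later digit difference is at least
   [-(q m.+1 - 1) / 2], so [2 * diff m.+1 - 1 >= q m.+1 * (2 * diff m - 1)]. *)
have step m : (n < m)%N ->
    (2 * D%:~R - 1) / qprod q n.+1 <= (2 * diff m - 1) / qprod q m.
  elim: m => // m IH; rewrite ltnS leq_eqVlt => /orP[/eqP <-|nm].
    by rewrite /diff !numS num_n addrAC opprD addNKr addrC.
  apply: le_trans (IH nm) _.
  have qm : 0 < (q m.+1)%:R :> R by rewrite ltr0n q_gt0.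
  have Pm := qprod_gt0 (R := R) m q_gt0.
  rewrite qprodS ler_pdivrMr// -mulrA [(_ * _)^-1 * _]mulrC mulrA.
  rewrite ler_pdivlMr ?mulr_gt0//.
  rewrite mulrCA [leRHS]mulrC ler_pM2l//.
  have dm : diff m.+1 = diff m * (q m.+1)%:R
      + (cantor_choice z m.+1 - cantor_choice y m.+1)%:~R.
    rewrite /diff !numS -[(q m.+1)%:R]/((q m.+1)%:Z%:~R).
    by rewrite -rmorphM -rmorphD/=; congr (_%:~R); ring.
  have : - ((q m.+1)%:R - 1) <= 2 * (cantor_choice z m.+1 - cantor_choice y m.+1)%:~R :> R.
    rewrite -[(q m.+1)%:R]/((q m.+1)%:Z%:~R) -[1]/(1%:~R) -rmorphB/=.
    rewrite -rmorphN -[2]/(2%:~R) -rmorphM ler_int /cantor_choice.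
    have m1 : (1 <= m.+1)%N by [].
    have := cantor_index_mod_lt y m1; have := cantor_index_mod_lt z m1.
    by have := N_half m1; lia.
  rewrite dm; lra.
have D1 : 1 <= D%:~R :> R by rewrite -[1]/(1%:~R) ler_int /D; lia.
have Pn := qprod_gt0 (R := R) n.+1 q_gt0.
(* Each point lies within [1 / qprod q m] of its truncation, so it suffices to compare truncations
   at a large [m]. *)
apply/ler_addgt0Pr => e e0.
have [m0 m0e] := N_unbounded e^-1.
pose m := maxn m0 n.+1.
have Pm0 := qprod_gt0 (R := R) m q_gt0.
have PmN : e^-1 < qprod q m.
  apply: lt_le_trans m0e _; apply: (@le_trans _ _ (qprod q m0)).
    by apply: le_qprod => j j1; have := loN_le j1; lia.
  by apply: qprod_nondecreasing => //; exact: leq_maxl.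
have := step m (leq_maxr _ _).
have /andP[zlow _] : (num (cantor_choice z) m)%:~R / qprod q m <= cantor_point z
    < (num (cantor_choice z) m + 1)%:~R / qprod q m.
  have [_ _ _ /(cantor_num_cvg _ _ q_gt0) lim] := cantor_pointP z.
  exact: (cantor_floor q_gt0 (@cantor_choice_itv z) (@cantor_choice_inf z)).
have /andP[_ yup] : (num (cantor_choice y) m)%:~R / qprod q m <= cantor_point y
    < (num (cantor_choice y) m + 1)%:~R / qprod q m.
  have [_ _ _ /(cantor_num_cvg _ _ q_gt0) lim] := cantor_pointP y.
  exact: (cantor_floor q_gt0 (@cantor_choice_itv y) (@cantor_choice_inf y)).
have ePm : (qprod q m)^-1 < e.
  by rewrite -[e]invrK ltf_pV2 ?posrE ?invr_gt0.
(* Since [D >= 1], [2 * D - 1 >= D]; this is where half a unit is given up. *)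
have : 2 * (D%:~R / (2 * qprod q n.+1)) <= (2 * D%:~R - 1) / qprod q n.+1 :> R.
  have -> : 2 * (D%:~R / (2 * qprod q n.+1)) = D%:~R / qprod q n.+1 :> R.
    by field; rewrite gt_eqF.
  by rewrite ler_pM2r ?invr_gt0//; lra.
have -> : diff m = (num (cantor_choice z) m)%:~R - (num (cantor_choice y) m)%:~R.
  by rewrite /diff rmorphB.
move: zlow yup; rewrite rmorphD /= mulrDl mul1r.
move: (num _ m)%:~R (num _ m)%:~R (_ / (2 * _)) (_ / qprod q n.+1) ePm.
move: (qprod q m)^-1 => iq ny nz G A ePm zlow yup GA.
have -> : (2 * (nz - ny) - 1) * iq = 2 * (nz * iq) - 2 * (ny * iq) - iq by ring.
move: (nz * iq) (ny * iq) zlow yup => u v zlow yup; lra.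
Qed.

(** At the first index where [y] and [z] differ, by [D] say, their distance is at most
    [(D + 1) / qprod N n <= 2 * D / qprod N n], while the points are [D / (2 * qprod q n)] apart.
    Splitting [D] into its powers of exponents [d] and [1 - d] and bounding the second by that of
    [N n] leaves the hypothesis. A first difference needs two available digits, so only places with
    [1 < N n] matter. *)
Lemma cantor_point_holder (d K : R) : 0 < d < 1 -> 0 < K ->
  (forall n, (1 <= n)%N -> (1 < N n)%N ->
     qprod q n `^ d * (N n)%:R `^ (1 - d) <= K * qprod N n) ->
  forall y z, 0 <= y < 1 -> 0 <= z < 1 ->
    `|y - z| <= 2 * 2 `^ d * K * `|cantor_point y - cantor_point z| `^ d.
Proof.
move=> d01 K0 HK y z y01 z01.
wlog yz : y z y01 z01 / y < z.
  move=> W; have [yz|zy|->] := ltgtP y z; first exact: W.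
    by rewrite distrC [`|cantor_point y - _|]distrC; exact: W.
  by rewrite subrr normr0 mulr_ge0 ?powR_ge0// !mulr_ge0 ?powR_ge0// ltW.
have [y0 y1] := andP y01; have [z0 z1] := andP z01.
have PN n : 0 < qprod N n :> R by exact: qprod_gt0.
have ex : exists n, cantor_index y n != cantor_index z n.
  have [n nyz] := N_unbounded (z - y)^-1; exists n.
  apply/eqP => E.
  have /truncn_itv/andP[_] : 0 <= qprod N n * z by rewrite mulr_ge0// ltW.
  have /truncn_itv/andP[+ _] : 0 <= qprod N n * y by rewrite mulr_ge0// ltW.
  rewrite -!/(cantor_index _ _) -E -addn1 natrD => a b.
  have zy : 0 < z - y by rewrite subr_gt0.
  move: nyz; rewrite -(ltr_pM2r zy) mulVf ?gt_eqF//.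
  by rewrite mulrBr; lra.
have := ex_minnP ex => -[[|n] nE nmin].
  case/eqP: nE; rewrite /cantor_index qprod0 !mul1r.
  by rewrite !(@truncn_def _ _ 0).
have indE m : (m <= n)%N -> cantor_index y m = cantor_index z m.
  by move=> mn; apply/eqP; apply: contraLR mn => /nmin; rewrite -ltnNge.
have ind_lt : (cantor_index y n.+1 < cantor_index z n.+1)%N.
  rewrite ltn_neqAle nE/=; apply: le_truncn.
  by rewrite ler_pM2l// ltW.
set Iy := cantor_index y n.+1; set Iz := cantor_index z n.+1.
pose a := (Iy %% N n.+1)%N; pose b := (Iz %% N n.+1)%N.
have [k [Iyk Izk]] : exists k, Iy = (k + a)%N /\ Iz = (k + b)%N.
  exists (cantor_index z n * N n.+1)%N.
  by rewrite -{1}indE// /Iy /Iz -!cantor_indexS.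
have ab : (a < b)%N by move: ind_lt; rewrite -/Iy -/Iz Iyk Izk ltn_add2l.
have bN : (b < N n.+1)%N by exact: cantor_index_mod_lt.
have := @cantor_point_gap y z n.
have -> : cantor_choice z n.+1 - cantor_choice y n.+1 = (b - a)%N.
  by rewrite /cantor_choice -/Iy -/Iz -/a -/b -subzn ?(ltnW ab)// !PoszD; ring.
set D := (b - a)%N => gap.
have D0 : (1 <= D)%N by rewrite subn_gt0.
have DN : (D <= N n.+1)%N by exact: leq_trans (leq_subr _ _) (ltnW bN).
have D0' : 0 < D%:R :> R by rewrite ltr0n.
have {}gap : D%:R / (2 * qprod q n.+1) <= cantor_point z - cantor_point y.
  apply: gap => [[|m] mn//|]; first by rewrite /cantor_choice indE.
  by rewrite /cantor_choice -/Iy -/Iz -/a -/b ltz_nat ltn_add2l.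
have Pq := qprod_gt0 (R := R) n.+1 q_gt0.
have {}gap : D%:R `^ d / (2 `^ d * qprod q n.+1 `^ d) <=
    `|cantor_point y - cantor_point z| `^ d.
  have P2 : 0 < 2 * qprod q n.+1 :> R by rewrite mulr_gt0.
  have G0 : 0 <= D%:R / (2 * qprod q n.+1) :> R by rewrite divr_ge0// ltW.
  rewrite -powRM ?(ltW Pq)// -powRN -mulN1r powRrM powR_inv1 ?(ltW P2)//.
  rewrite -powRM ?invr_ge0 ?(ltW P2)//.
  apply: ge0_ler_powR; rewrite ?nnegrE//; first lra.
  by rewrite distrC ger0_norm// (le_trans G0).
rewrite distrC ger0_norm ?subr_ge0 ?(ltW yz)//.
have DI : D%:R = Iz%:R - Iy%:R :> R.
  by rewrite -natrB ?(ltnW ind_lt)// /D Iyk Izk subnDl.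
have yzD : z - y <= 2 * D%:R / qprod N n.+1.
  rewrite ler_pdivlMr// mulrC mulrBr.
  have /truncn_itv/andP[_] : 0 <= qprod N n.+1 * z by rewrite mulr_ge0// ltW.
  have /truncn_itv/andP[+ _] : 0 <= qprod N n.+1 * y by rewrite mulr_ge0// ltW.
  rewrite -!/(cantor_index _ _) -/Iy -/Iz -natr1.
  have : 1 <= D%:R :> R by rewrite ler1n.
  by rewrite DI; lra.
apply: (le_trans yzD).
have K2 : 0 <= 2 * 2 `^ d * K.
  by rewrite mulr_ge0 ?(ltW K0)// mulr_ge0// powR_ge0.
apply: le_trans (ler_wpM2l K2 gap).
have N1 : (1 < N n.+1)%N by apply: leq_ltn_trans bN; apply: leq_ltn_trans ab.
have := HK _ (ltn0Sn n) N1.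
have Dd : D%:R `^ (1 - d) <= (N n.+1)%:R `^ (1 - d) :> R.
  by apply: ge0_ler_powR; rewrite ?nnegrE ?ler_nat//; lra.
have DE : D%:R = D%:R `^ d * D%:R `^ (1 - d) :> R.
  rewrite -powRD; last by rewrite pnatr_eq0 -lt0n D0 implybT.
  by rewrite addrC subrK powRr1.
have a0 : 0 < qprod q n.+1 `^ d by exact: powR_gt0.
have b0 : 0 < 2 `^ d :> R by exact: powR_gt0.
have c0 : 0 < D%:R `^ d :> R by exact: powR_gt0.
move=> H; rewrite ler_pdivrMr//.
have -> : 2 * 2 `^ d * K * (D%:R `^ d / (2 `^ d * qprod q n.+1 `^ d)) * qprod N n.+1
    = 2 * D%:R `^ d * ((K * qprod N n.+1) / qprod q n.+1 `^ d).
  by field; rewrite !gt_eqF.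
have -> : 2 * D%:R = 2 * D%:R `^ d * D%:R `^ (1 - d) :> R by rewrite -mulrA -DE.
rewrite ler_pM2l ?mulr_gt0// ler_pdivlMr// mulrC.
by apply: le_trans H; rewrite ler_pM2l.
Qed.

End HomogeneousCantorSet.

(** * The explicit word for a run of constant base, and the count of a block in its initial
    segments *)

Section NormalWord.
Local Open Scope nat_scope.
Implicit Types (b p i j k : nat).

(** About the cube root of [b]: with [M] slots of [M.+1] letters, all slots fit into a period of
    length [b] and fill a share of it that tends to 0. The bound [m < b] only makes the maximum
    finite. *)
Definition slots b : nat := \max_(m < b | m.+1 ^ 3 <= b) m.

Lemma slots_le b : 0 < b -> (slots b).+1 ^ 3 <= b.
Proof.
move=> b0; rewrite /slots; elim/big_ind: _ => //= x y xb yb.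
by rewrite /maxn; case: ifP.
Qed.

Lemma le_slots m b : m.+1 ^ 3 <= b -> m <= slots b.
Proof.
move=> mb; have mltb : m < b.
  by apply: leq_trans mb; have := @leq_pexp2l m.+1 1 3 isT isT; rewrite expn1.
exact: (@leq_bigmax_cond _ _ (fun i : 'I_b => i : nat) (Ordinal mltb)).
Qed.

Lemma slots_mul_lt b : 0 < b -> slots b * (slots b).+1 < b.
Proof.
move=> b0; apply: leq_trans (slots_le b0).
by rewrite !expnS expn0 muln1; nia.
Qed.

Definition slot_word i : seq nat := odflt [::] (pickle_inv i).

(* The word is written in periods of length [b].  The [i]-th slot of every
   period is reserved for the finite word [w] with code [i], which is written
   once every [b ^ size w] letters; all other letters are [b.-1]. *)
Definition normal_word b p : nat :=
  let M := slots b in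
  let w := slot_word (p %% b %/ M.+1) in
  let l := p %% b %% M.+1 in
  if [&& p %% b %/ M.+1 < M, l < size w, size w <= M, 0 < p %/ b
       & b ^ (size w).-1 %| p %/ b]
  then minn (nth 0 w l) b.-1 else b.-1.

Lemma normal_word_lt b p : 0 < b -> normal_word b p < b.
Proof.
move=> b0; rewrite /normal_word; case: ifP => _; last by rewrite prednK.
by apply: leq_ltn_trans (geq_minr _ _) _; rewrite prednK.
Qed.

Lemma normal_wordE b r i l : 0 < b -> i < slots b -> l <= slots b ->
  normal_word b (r * b + (i * (slots b).+1 + l)) =
  if [&& l < size (slot_word i), size (slot_word i) <= slots b, 0 < r
       & b ^ (size (slot_word i)).-1 %| r]
  then minn (nth 0 (slot_word i) l) b.-1 else b.-1.
Proof.
move=> b0 iM lM; have Mb := slots_mul_lt b0.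
have clt : i * (slots b).+1 + l < b.
  apply: leq_ltn_trans Mb; apply: (@leq_trans (i.+1 * (slots b).+1)).
    by rewrite mulSn addnC leq_add2r ltnW.
  by rewrite leq_mul2r iM orbT.
set c := i * _ + l in clt *.
have cb : (r * b + c) %% b = c by rewrite modnMDl modn_small.
have rb : (r * b + c) %/ b = r by rewrite divnMDl// divn_small// addn0.
have ci : c %/ (slots b).+1 = i by rewrite divnMDl// divn_small// addn0.
have cl : c %% (slots b).+1 = l by rewrite modnMDl modn_small.
by rewrite /normal_word cb rb ci cl iM.
Qed.

(** [P <= p] reflects the blank first period. As 0 is divisible by every power of [b], period 0
    would otherwise carry every word, and each long word could add 1 to the count. *)
Definition residue_from (P a p : nat) : bool := (P <= p) && (p %% P == a).

(** The first [P] positions hold no solution and each later block of [P] exactly one, so the upper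
    bound has no additive term. *)
Lemma sum_residue_from P a j : a < P ->
  (\sum_(0 <= p < j) residue_from P a p <= j %/ P) /\
  (j %/ P <= (\sum_(0 <= p < j) residue_from P a p).+1).
Proof.
move=> aP; have P0 : 0 < P by apply: leq_ltn_trans aP.
set S := fun j => \sum_(0 <= p < j) residue_from P a p; rewrite -/(S j).
have SP c : S (c.+1 * P) = c.
  elim: c => [|c IH].
    rewrite mul1n /S big_nat big1// => p /andP[_ pP].
    by rewrite /residue_from leqNgt pP.
  rewrite /S (@big_cat_nat _ _ _ (c.+1 * P))//=; last by rewrite leq_mul2r leqnSn orbT.
  rewrite -/(S _) IH -{1}[c.+1 * P]add0n big_addn.
  rewrite -mulnBl subSnn mul1n big_mkord (bigD1 (Ordinal aP))//= big1 => [|p pa].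
    rewrite /residue_from [a + _]addnC modnMDl modn_small// eqxx andbT.
    by rewrite mulSn -addnA leq_addr addn0 addn1.
  rewrite /residue_from [p + _]addnC modnMDl modn_small//.
  by move: pa; rewrite -val_eqE/= => /negbTE ->; rewrite andbF.
have Smono : {homo S : m n / m <= n}.
  move=> m n mn; rewrite /S [leqRHS](@big_cat_nat _ _ _ m)//=.
  exact: leq_addr.
split.
  rewrite -(SP (j %/ P)); apply: Smono; apply: ltnW; exact: ltn_ceil.
case E : (j %/ P) => [//|c]; rewrite ltnS -{1}(SP c) -E.
by apply: Smono; exact: leq_divM.
Qed.

Section BlockCount.
Variables (k : nat) (B : k.-tuple nat) (b : nat).
Hypothesis k_gt0 : 0 < k.
Hypothesis k_le : k <= slots b.
Hypothesis code_lt : pickle (B : seq nat) < slots b.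
Hypothesis B_lt : forall i : 'I_k, tnth B i < b.-1.

Definition word_match p : bool := [forall i : 'I_k, normal_word b (p + i) == tnth B i].

Let b_gt0 : 0 < b.
Proof. by have := B_lt (Ordinal k_gt0); case: (b). Qed.

Let nthB (i : 'I_k) : nth 0 (B : seq nat) i = tnth B i.
Proof. by rewrite (tnth_nth 0). Qed.

Let slot_word_B : slot_word (pickle (B : seq nat)) = B.
Proof. by rewrite /slot_word pickleK_inv. Qed.

Lemma residue_word_match p :
  residue_from (b ^ k) (pickle (B : seq nat) * (slots b).+1) p -> word_match p.
Proof.
case/andP => bp /eqP pE; have pdiv := divn_eq p (b ^ k).
rewrite pE in pdiv; have q0 : 0 < p %/ b ^ k by rewrite divn_gt0// expn_gt0 b_gt0.
apply/forallP => i; rewrite pdiv -addnA.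
have -> : p %/ b ^ k * b ^ k = p %/ b ^ k * b ^ k.-1 * b.
  by rewrite -mulnA -expnSr prednK.
rewrite normal_wordE//; last by apply: leq_trans (ltnW (ltn_ord i)) k_le.
rewrite slot_word_B size_tuple ltn_ord k_le muln_gt0 q0 expn_gt0 b_gt0 dvdn_mull//=.
by rewrite nthB; apply/eqP/minn_idPl/ltnW.
Qed.

(* Every slot ends with the filler [b.-1], so an occurrence of [B] lies inside
   one written word: either [B] itself, or a longer word, which is written at
   most once every [b ^ k.+1] letters. *)
Lemma word_match_residue p : word_match p ->
  residue_from (b ^ k) (pickle (B : seq nat) * (slots b).+1) p \/
  exists2 c, c < slots b * (slots b).+1 & residue_from (b ^ k.+1) c p.
Proof.
move=> /forallP match_p.
have nonfill (e : 'I_k) : normal_word b (p + e) != b.-1.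
  by rewrite (eqP (match_p e)) neq_ltn B_lt.
set r := p %/ b; set i := p %% b %/ (slots b).+1; set l := p %% b %% (slots b).+1.
have pE : p = r * b + (i * (slots b).+1 + l) by rewrite -divn_eq -divn_eq.
have lM : l <= slots b by rewrite -ltnS ltn_mod.
have := nonfill (Ordinal k_gt0); rewrite addn0 {1}/normal_word -/r -/i -/l.
case: ifP => [/and5P[iM lw wM r0 dr] _|_]; last by rewrite eqxx.
(* The period number of a written word of size above [m] is a multiple of [b ^ m]. Used with [m = k]
   for longer words and [m = k.-1] for [B] itself. *)
have resE m : m <= (size (slot_word i)).-1 ->
    residue_from (b ^ m.+1) (i * (slots b).+1 + l) p.
  move=> mw; have /dvdnP[s rE] : b ^ m %| r.
    by apply: dvdn_trans dr; rewrite dvdn_exp2l.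
  have clt : i * (slots b).+1 + l < b ^ m.+1.
    rewrite -divn_eq; apply: leq_trans (ltn_pmod _ b_gt0) _.
    by have := @leq_pexp2l b 1 m.+1 b_gt0 isT; rewrite expn1.
  have s0 : 0 < s by move: r0; rewrite rE muln_gt0 => /andP[].
  rewrite /residue_from pE rE -mulnA -expnSr modnMDl modn_small// eqxx andbT.
  by apply: leq_trans (leq_addr _ _); rewrite -{1}[b ^ _]mul1n leq_mul2r s0 orbT.
have [wk|kw] := leqP (size (slot_word i)) k; last first.
  right; exists (i * (slots b).+1 + l).
    apply: (@leq_trans (i.+1 * (slots b).+1)); last by rewrite leq_mul2r iM orbT.
    by rewrite mulSn addnC ltn_add2r ltnS.
  by apply: resE; rewrite -ltnS prednK// (leq_ltn_trans _ kw).
left.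
(* An occurrence passing the end of the word would contain the letter at offset
   [size (slot_word i) <= slots b], still in the same slot and equal to the filler. *)
have lk : l + k <= size (slot_word i).
  rewrite leqNgt; apply/negP => wlk.
  have ek : size (slot_word i) - l < k by rewrite ltn_subLR// ltnW.
  have := nonfill (Ordinal ek).
  rewrite /= pE -addnA -addnA subnKC; last exact: ltnW.
  by rewrite normal_wordE// ltnn eqxx.
have l0 : l = 0 by apply/eqP; rewrite -leqn0; lia.
have wsize : size (slot_word i) = k by lia.
have wB : slot_word i = B.
  apply: (@eq_from_nth _ 0); first by rewrite size_tuple.
  move=> e; rewrite wsize => ek.
  have := match_p (Ordinal ek); rewrite pE -addnA -addnA l0 add0n.
  rewrite normal_wordE//; last by rewrite (leq_trans (ltnW _) wM)// wsize.
  have -> : Ordinal ek < size (slot_word i) by rewrite wsize.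
  rewrite wM r0 dr /= => /eqP.
  rewrite -(nthB (Ordinal ek))/= => E.
  have := B_lt (Ordinal ek); rewrite -(nthB (Ordinal ek))/= -E.
  by rewrite gtn_min ltnn orbF => /ltnW/minn_idPl.
have iB : i = pickle (B : seq nat).
  have : slot_word i != [::] by rewrite -size_eq0 wsize -lt0n.
  move: wB; rewrite /slot_word; have := pickle_invK (T := seq nat) i.
  by case: (pickle_inv i) => //= w <- -> _.
by have := resE k.-1; rewrite wsize leqnn prednK// l0 addn0 iB; exact.
Qed.

(** Only the planted copies are counted. The 2 covers the blank first stretch of [b ^ k] letters and
    the rounding of [j / b ^ k]. *)
Lemma sum_word_match_ge j :
  j <= (\sum_(0 <= p < j) word_match p + 2) * b ^ k.
Proof.
set a := pickle (B : seq nat) * (slots b).+1.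
have bk : 0 < b ^ k by rewrite expn_gt0 b_gt0.
have aP : a < b ^ k.
  apply: (@leq_trans b); last first.
    by have := @leq_pexp2l b 1 k b_gt0 k_gt0; rewrite expn1.
  by apply: leq_ltn_trans (slots_mul_lt b_gt0); rewrite leq_mul2r ltnW.
have [_ jle] := sum_residue_from j aP.
have Sle : \sum_(0 <= p < j) residue_from (b ^ k) a p <= \sum_(0 <= p < j) word_match p.
  apply: leq_sum => p _; case E : (residue_from _ _ _) => //.
  by rewrite (residue_word_match E).
apply: (@leq_trans ((j %/ b ^ k).+1 * b ^ k)); first exact/ltnW/ltn_ceil.
by rewrite leq_mul2r addn2 !ltnS (leq_trans jle)// orbT.
Qed.

(** The class of [B] itself gives at most [j / b ^ k], and each of the [slots b * (slots b).+1]
    places in longer words at most [j / b ^ k.+1]. There is no additive constant, whatever the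
    number of these places. *)
Lemma sum_word_match_le j :
  (\sum_(0 <= p < j) word_match p) * b ^ k.+1 <= j * (b + slots b * (slots b).+1).
Proof.
set a := pickle (B : seq nat) * (slots b).+1.
have bm m : 0 < m -> b <= b ^ m 
  by move=> m0; have := @leq_pexp2l b 1 m b_gt0 m0; rewrite expn1.
have aP : a < b ^ k.
  apply: leq_trans (bm _ k_gt0).
  by apply: leq_ltn_trans (slots_mul_lt b_gt0); rewrite leq_mul2r ltnW.
have [jle _] := sum_residue_from j aP.
have Sle : \sum_(0 <= p < j) word_match p <=
    \sum_(0 <= p < j) residue_from (b ^ k) a p
    + \sum_(c < slots b * (slots b).+1) \sum_(0 <= p < j) residue_from (b ^ k.+1) c p.
  rewrite exchange_big -big_split/=; apply: leq_sum => p _.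
  case E : (word_match p) => //; case: (word_match_residue E) => [->//|[c cM cp]].
  by rewrite (bigD1 (Ordinal cM))//= cp addnCA.
apply: (@leq_trans ((j %/ b ^ k + slots b * (slots b).+1 * (j %/ b ^ k.+1)) * b ^ k.+1)).
  rewrite leq_mul2r; apply/orP; right; apply: (leq_trans Sle); apply: leq_add => //.
  apply: leq_trans (_ : \sum_(c < slots b * (slots b).+1) j %/ b ^ k.+1 <= _); last first.
    by rewrite sum_nat_const card_ord.
  apply: leq_sum => c _.
  apply: (proj1 (sum_residue_from _ _)); apply: leq_trans (bm _ _) => //.
  exact: ltn_trans (ltn_ord c) (slots_mul_lt b_gt0).
rewrite mulnDl mulnDr leq_add//.
  by rewrite expnSr mulnA leq_mul2r leq_divM orbT.
by rewrite -mulnA [leqRHS]mulnC leq_mul2l leq_divM orbT.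
Qed.

End BlockCount.
End NormalWord.

(** * The concatenation as a sequence of units *)

(* The concatenation is cut into units [alpha_i]^{s_i} [beta_i]^{t_i}, numbered
   from 0; [stage u] is the index [i] of the [u]-th unit. *)
Section Units.
Variables alpha beta s t upsilon q : nat -> nat.
Hypothesis q_concat : is_concatenation alpha beta s t upsilon q.
Local Open Scope nat_scope.

Definition unit_word i : seq nat := nseq (s i) (alpha i) ++ nseq (t i) (beta i).

Definition units_before N : nat := \sum_(1 <= i < N.+1) upsilon i.

Lemma units_beforeS N : units_before N.+1 = units_before N + upsilon N.+1.
Proof. by rewrite /units_before big_nat_recr. Qed.

Lemma leq_units_before : {homo units_before : m n / m <= n}.
Proof.
move=> m n mn; rewrite /units_before [leqRHS](@big_cat_nat _ _ _ m.+1)//=.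
exact: leq_addr.
Qed.

Lemma stage_prefixS N :
  stage_prefix alpha beta s t upsilon N.+1 =
  stage_prefix alpha beta s t upsilon N ++
  flatten (nseq (upsilon N.+1) (unit_word N.+1)).
Proof.
rewrite /stage_prefix -[in LHS](addn1 N) iotaD map_cat flatten_cat/= cats0.
by rewrite add1n.
Qed.

Lemma size_stage_prefix N : size (stage_prefix alpha beta s t upsilon N) =
  \sum_(1 <= i < N.+1) upsilon i * (s i + t i).
Proof.
elim: N => [|N IH]; first by rewrite big_geq.
rewrite stage_prefixS size_cat IH [RHS]big_nat_recr//=; congr addn.
rewrite size_flatten /shape map_nseq sumn_nseq mulnC.
by rewrite /unit_word size_cat !size_nseq mulnC.
Qed.

(** If the counts were bounded they would reach a maximum, after which every [upsilon] vanishes and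
    the prefixes stop growing, although the concatenation is infinite. *)
Lemma units_before_unbounded m : exists N, m < units_before N.
Proof.
apply: contrapT => /forallNP noN.
have bnd N : units_before N <= m by rewrite leqNgt; apply/negP.
have exU : exists x, `[< exists N, units_before N = x >].
  by exists (units_before 0); apply/asboolP; exists 0.
have ubU x : `[< exists N, units_before N = x >] -> x <= m.
  by move=> /asboolP[N <-].
case: (ex_maxnP exU ubU) => _ /asboolP[N0 <-] maxN0.
have [H _] := q_concat.
have [N] := H (size (stage_prefix alpha beta s t upsilon N0)).+1.
rewrite ltnNge => /negP; apply; rewrite !size_stage_prefix.
have [NN0|N0N] := leqP N N0.
  by rewrite [leqRHS](@big_cat_nat _ _ _ N.+1)//= leq_addr.
rewrite [leqLHS](@big_cat_nat _ _ _ N0.+1)//=; last by rewrite ltnS ltnW.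
rewrite [X in _ + X <= _]big_nat [X in _ + X <= _]big1 ?addn0// => i /andP[N0i iN].
have : units_before i <= units_before N0 by apply: maxN0; apply/asboolP; exists i.
case: i N0i iN => // i N0i _; rewrite units_beforeS.
have : units_before N0 <= units_before i by exact: leq_units_before.
by case: (upsilon i.+1) => [|v]; [rewrite mul0n|lia].
Qed.

Definition stage u : nat := ex_minn (units_before_unbounded u).

Lemma lt_units_before_stage u : u < units_before (stage u).
Proof. by rewrite /stage; case: ex_minnP. Qed.

Lemma stage_le u N : u < units_before N -> stage u <= N.
Proof. by rewrite /stage; case: ex_minnP => m _ H /H. Qed.

Lemma stage_gt0 u : 0 < stage u.
Proof.
case E : (stage u) (lt_units_before_stage u) => //.
by rewrite /units_before big_geq.
Qed.

Lemma units_before_pred_stage u : units_before (stage u).-1 <= u.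
Proof.
rewrite leqNgt; apply/negP => /stage_le.
by case: (stage u) (stage_gt0 u) => // n _; rewrite ltnn.
Qed.

Lemma stage_ge m u : units_before m <= u -> m < stage u.
Proof.
move=> mu; rewrite ltnNge; apply/negP => /leq_units_before.
by move/(leq_trans (lt_units_before_stage u)); rewrite ltnNge mu.
Qed.

Lemma stageE N u : units_before N <= u < units_before N.+1 -> stage u = N.+1.
Proof.
case/andP => Nu uN; apply/eqP; rewrite eqn_leq stage_le//=.
exact: stage_ge.
Qed.

(** Turns the sums over stages weighted by [upsilon], in which the hypotheses are stated, into sums
    over units. *)
Lemma sum_stage (V : nmodType) (f : nat -> V) N :
  (\sum_(0 <= v < units_before N) f (stage v) =
   \sum_(1 <= i < N.+1) f i *+ upsilon i)%R.
Proof.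
elim: N => [|N IH]; first by rewrite /units_before !big_geq.
rewrite [RHS]big_nat_recr//= -IH.
rewrite (@big_cat_nat _ _ _ (units_before N))//=; last exact: leq_units_before.
congr (_ + _)%R; rewrite (eq_big_nat _ _ (F2 := fun=> f N.+1)); last first.
  by move=> v /stageE ->.
by rewrite big_const_nat iter_addr addr0 units_beforeS addKn.
Qed.

Lemma stage_prefixE N : stage_prefix alpha beta s t upsilon N =
  flatten [seq unit_word (stage v) | v <- iota 0 (units_before N)].
Proof.
elim: N => [|N IH]; first by rewrite /units_before big_geq.
rewrite stage_prefixS IH units_beforeS iotaD map_cat flatten_cat add0n.
congr (_ ++ flatten _); apply: (@eq_from_nth _ [::]).
  by rewrite size_nseq size_map size_iota.
move=> v; rewrite size_nseq => vN; rewrite nth_nseq vN.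
rewrite (nth_map 0) ?size_iota// nth_iota// (@stageE N)//.
by rewrite leq_addr units_beforeS ltn_add2l.
Qed.

Definition unit_len u : nat := s (stage u) + t (stage u).
Definition unit_start u : nat := \sum_(0 <= v < u) unit_len v.

Lemma unit_startS u : unit_start u.+1 = unit_start u + unit_len u.
Proof. by rewrite /unit_start big_nat_recr. Qed.

Lemma size_flatten_units u :
  size (flatten [seq unit_word (stage v) | v <- iota 0 u]) = unit_start u.
Proof.
elim: u => [|u IH]; first by rewrite /unit_start big_geq.
rewrite -addn1 iotaD map_cat flatten_cat size_cat IH/= cats0 addn1 unit_startS.
by rewrite add0n /unit_word size_cat !size_nseq.
Qed.

Lemma size_stage_prefix_start N :
  size (stage_prefix alpha beta s t upsilon N) = unit_start (units_before N).
Proof. by rewrite stage_prefixE size_flatten_units. Qed.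

Lemma unit_digit u p : p < unit_len u ->
  q (unit_start u + p).+1 =
  if p < s (stage u) then alpha (stage u) else beta (stage u).
Proof.
move=> pu; have [_ H] := q_concat; pose N := stage u.
have uN : u < units_before N := lt_units_before_stage u.
have lt : unit_start u + p < size (stage_prefix alpha beta s t upsilon N).
  rewrite size_stage_prefix_start; apply: (@leq_trans (unit_start u.+1)).
    by rewrite unit_startS ltn_add2l.
  by rewrite /unit_start [leqRHS](@big_cat_nat _ _ _ u.+1)//= leq_addr.
rewrite (H N)// stage_prefixE -(subnKC uN) -addn1 -addnA iotaD map_cat flatten_cat.
rewrite nth_cat size_flatten_units ltnNge leq_addr/= addKn add0n.
rewrite nth_cat {1}/unit_word size_cat !size_nseq -/(unit_len u) pu.
rewrite /unit_word nth_cat size_nseq; case: ifP => ps; rewrite nth_nseq ?ps//.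
by rewrite ltn_subLR ?pu// leqNgt ps.
Qed.

Lemma unit_position j : exists u p, p < unit_len u /\ j = unit_start u + p.
Proof.
have [H _] := q_concat; have [N jN] := H j.+1.
rewrite size_stage_prefix_start in jN.
have := ex_minnP (ex_intro (fun u => j < unit_start u) _ jN) => -[[|u] ju umin].
  by rewrite /unit_start big_geq in ju.
have uj : unit_start u <= j by rewrite leqNgt; apply/negP => /umin; rewrite ltnn.
exists u, (j - unit_start u); rewrite subnKC//; split => //.
by rewrite ltn_subLR// -unit_startS.
Qed.

Lemma leq_unit_start : {homo unit_start : u v / u <= v}.
Proof.
move=> u v uv; rewrite /unit_start [leqRHS](@big_cat_nat _ _ _ u)//=.
exact: leq_addr.
Qed.

Lemma unit_start_ge m : exists u0, forall u, u0 <= u -> m <= unit_start u.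
Proof.
have [u [p [pu ->]]] := unit_position m; exists u.+1 => v uv.
apply: leq_trans (leq_unit_start uv).
by rewrite unit_startS leq_add2l ltnW.
Qed.

Definition unit_of j : nat := projT1 (cid (unit_position j)).
Definition offset_of j : nat := j - unit_start (unit_of j).

Lemma unit_ofE u p : p < unit_len u -> unit_of (unit_start u + p) = u.
Proof.
rewrite /unit_of; case: cid => v /= [r [rv E]] pu.
case: (ltngtP v u) => // [vu|uv].
  have := leq_unit_start vu; rewrite unit_startS leqNgt => /negP[].
  by rewrite (@leq_ltn_trans (unit_start u + p)) ?leq_addr// E ltn_add2l.
have := leq_unit_start uv; rewrite unit_startS leqNgt => /negP[].
by rewrite (@leq_ltn_trans (unit_start v + r)) ?leq_addr// -E ltn_add2l.
Qed.

Lemma offset_ofE u p : p < unit_len u -> offset_of (unit_start u + p) = p.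
Proof. by move=> pu; rewrite /offset_of unit_ofE// addKn. Qed.

End Units.
Lemma quotient_cvg0_le (R : realType) (a b : nat -> R) (e : R) :
  quotient_cvg0 a b -> 0 < e ->
  exists n0, forall n, (n0 <= n)%N -> b n != 0 /\ `|a n| <= e * `|b n|.
Proof.
move=> [b0 ab] e0.
have ab_le : \forall n \near \oo, `|a n / b n| <= e by exact: cvgr0_norm_le.
have [n0 _ H] := filterI b0 ab_le; exists n0 => n /H[/= bn].
by rewrite normrM normfV ler_pdivrMr ?normr_gt0.
Qed.

Lemma unbounded_infinite (A : set nat) :
  (forall m, exists2 n, (m <= n)%N & A n) -> infinite_set A.
Proof.
move=> unbA /finite_fsetP[X AX].
have [n ltn] := unbA (\max_(i <- finmap.enum_fset X) i).+1.
by rewrite AX /= => nX; move: ltn; rewrite ltnNge (@leq_bigmax_seq _ _ xpredT id n nX).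
Qed.

(** Bounds the windows of length [k] that start in a unit but run past its end: they start among its
    last places. *)
Lemma sum_window_le (k a b : nat) :
  (\sum_(a <= i < b) (b < i + k)%N <= k)%N.
Proof.
have [bak|akb] := leqP b (a + k).
  apply: (@leq_trans (\sum_(a <= i < b) 1)); first by apply: leq_sum => i _; case: ltnP.
  by rewrite sum_nat_const_nat muln1 leq_subLR.
rewrite (@big_cat_nat _ _ _ (b - k))/=; [|lia..].
rewrite big_nat big1 => [|i /andP[_ ib]]; last by apply/eqP; rewrite eqb0 -leqNgt; lia.
apply: (@leq_trans (\sum_(b - k <= i < b) 1)); first by apply: leq_sum => i _; case: ltnP.
by rewrite sum_nat_const_nat muln1; lia.
Qed.

(** * The digit ranges for [Q], and the dimension estimate *)

Section Construction.
Context {R : realType}.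
Variables alpha beta s t upsilon Q : nat -> nat.
Hypothesis h_alpha : basic_sequence alpha.
Hypothesis h_beta : basic_sequence beta.
Hypothesis hQ : is_concatenation alpha beta s t upsilon Q.
Hypothesis hQ_lim : infinite_in_limit Q.
Hypothesis h_sum : quotient_cvg0
  (fun n => (s n)%:R * ln ((alpha n)%:R : R))
  (fun n => \sum_(1 <= i < n)
     (upsilon i)%:R * (t i)%:R * ln ((beta i)%:R : R)).
Hypothesis h_log : quotient_cvg0
  (fun n => (s n)%:R * ln ((alpha n)%:R : R))
  (fun n => (t n)%:R * ln ((beta n)%:R : R)).
Hypothesis h_pow : forall m, (1 <= m)%N -> quotient_cvg0
  (fun n => (t n)%:R * (alpha n)%:R ^+ m : R)
  (fun n => (s n)%:R * (beta n)%:R ^+ m : R).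
Hypothesis h_pow_s : forall m, (1 <= m)%N -> quotient_cvg0
  (fun n => (alpha n)%:R ^+ m : R)
  (fun n => (s n)%:R : R).
Hypothesis h_density : quotient_cvg0
  (fun n => \sum_(1 <= i < n.+1) (upsilon i)%:R * (s i)%:R : R)
  (fun n => \sum_(1 <= i < n.+1)
     (upsilon i)%:R * ((s i)%:R + (t i)%:R) : R).

Let L := unit_start hQ.
Let len := unit_len hQ.
Let a u := alpha (stage hQ u).
Let b u := beta (stage hQ u).
Let S u := s (stage hQ u).
Let T u := t (stage hQ u).

Let LS u : L u.+1 = (L u + len u)%N. Proof. exact: unit_startS. Qed.
Let lenE u : len u = (S u + T u)%N. Proof. by []. Qed.

Let a_ge2 u : (2 <= a u)%N. Proof. exact/h_alpha/stage_gt0. Qed.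
Let b_ge2 u : (2 <= b u)%N. Proof. exact/h_beta/stage_gt0. Qed.

Let Qa u p : (p < S u)%N -> Q (L u + p).+1 = a u.
Proof.
by move=> pS; rewrite unit_digit ?pS// (leq_trans pS)// leq_addr.
Qed.

Let Qb u p : (S u <= p < len u)%N -> Q (L u + p).+1 = b u.
Proof. by case/andP => Sp pu; rewrite unit_digit// ltnNge Sp. Qed.

Lemma concat_ge2 j : (1 <= j)%N -> (2 <= Q j)%N.
Proof.
case: j => // j _; have [u [p [pu ->]]] := unit_position hQ j.
by rewrite unit_digit//; case: ifP => _; [exact: a_ge2|exact: b_ge2].
Qed.

Lemma concat_gt0 j : (1 <= j)%N -> (1 <= Q j)%N.
Proof. by move/concat_ge2/ltnW. Qed.

Lemma prod_concat_ge1 i j : (1 <= i)%N -> 1 <= \prod_(i <= l < j) (Q l)%:R :> R.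
Proof.
move=> i1; rewrite big_nat; elim/big_ind: _ => // [y z y1 z1|l /andP[il _]].
  exact: mulr_ege1.
by rewrite ler1n concat_gt0// (leq_trans i1).
Qed.

(** Each weight of order [j] is at least the one of order [k]. Claim (i) assumes divergence only at
    [k] but needs normality of every lower order. *)
Lemma k_divergent_le j k : (j <= k)%N -> k_divergent R Q k -> k_divergent R Q j.
Proof.
move=> jk /cvgryPge divQ; apply/cvgryPge => A; apply: filterS (divQ A) => n.
move=> /le_trans; apply; apply: ler_sum_nat => i /andP[i1 _].
have ge1 := prod_concat_ge1 _ i1; have gt0 m : 0 < \prod_(i <= l < m) (Q l)%:R :> R.
  exact: lt_le_trans ltr01 (ge1 m).
rewrite lef_pV2 ?posrE// [leRHS](@big_cat_nat _ _ _ (i + j)%N)/= ?leq_addr ?leq_add2l//.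
by rewrite ler_peMr ?(ltW (gt0 _))// prod_concat_ge1// (leq_trans i1)// leq_addr.
Qed.

Lemma eventually_stage (P : nat -> Prop) :
  (exists n0, forall n, (n0 <= n)%N -> P n) ->
  exists u0, forall u, (u0 <= u)%N -> P (stage hQ u).
Proof.
move=> [n0 H]; exists (units_before upsilon n0) => u /(stage_ge hQ) n0u.
exact/H/ltnW.
Qed.

Lemma eventually_params (e : R) k : 0 < e -> (0 < k)%N ->
  exists u0, forall u, (u0 <= u)%N ->
    [/\ (0 < S u)%N, (0 < T u)%N, (a u)%:R ^+ k <= e * (S u)%:R &
        (T u)%:R * (a u)%:R ^+ k <= e * ((S u)%:R * (b u)%:R ^+ k)].
Proof.
move=> e0 k0.
have [u1 H1] := eventually_stage (quotient_cvg0_le (h_pow_s k0) e0).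
have [u2 H2] := eventually_stage (quotient_cvg0_le (h_pow k0) e0).
have [u3 H3] := eventually_stage (quotient_cvg0_le h_log e0).
exists (maxn u1 (maxn u2 u3)) => u; rewrite !geq_max.
move=> /and3P[/H1[s0 as_le] /H2[_ tb] /H3[t0 _]].
split.
- by rewrite lt0n; move: s0; rewrite pnatr_eq0.
- by rewrite lt0n; move: t0; rewrite mulf_eq0 pnatr_eq0 negb_or => /andP[].
- by move: as_le; rewrite !ger0_norm ?exprn_ge0.
- by move: tb; rewrite !ger0_norm ?mulr_ge0 ?exprn_ge0.
Qed.

Lemma eventually_large m : exists u0, forall u, (u0 <= u)%N ->
  forall j, (L u <= j)%N -> (m <= Q j.+1)%N.
Proof.
have [n0 _ H] : \forall n \near \oo, (m <= Q n)%N := hQ_lim (nbhs_infty_ge m).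
have [u0 H0] := unit_start_ge hQ n0.
exists u0 => u /H0 n0L j Lj; apply: H => /=.
by rewrite (leq_trans n0L)// (leq_trans Lj).
Qed.

(** [infinite_in_limit] speaks only of terms that occur in [Q]; both bases of a late unit do occur,
    since [S u] and [T u] are eventually positive. *)
Lemma eventually_bases m : exists u0, forall u, (u0 <= u)%N ->
  (m <= a u)%N /\ (m <= b u)%N.
Proof.
have [u1 H1] := eventually_large m.
have [u2 H2] := @eventually_params 1 1 ltr01 isT.
exists (maxn u1 u2) => u; rewrite geq_max => /andP[/H1 Hm /H2[S0 T0 _ _]].
split; first by rewrite -(Qa S0) Hm// leq_addr.
rewrite -(@Qb u (S u)) ?Hm ?leq_addr//.
by rewrite leqnn lenE -{1}[S u]addn0 ltn_add2l.
Qed.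

(* The digit in position [j] ranges over the [digit_width j] integers starting
   at [digit_low j]. *)
Definition digit_low j : nat :=
  if j is j'.+1 then
    let u := unit_of hQ j' in let p := offset_of hQ j' in
    if (p < S u)%N then normal_word (a u) p else (b u - (b u)./2)%N
  else 0%N.

(** The [.-1] keeps the largest digit [b u - 1] out of the range, which secures infinitely many
    non-maximal digits; [maxn 1] covers the small bases. *)
Definition digit_width j : nat :=
  if j is j'.+1 then
    let u := unit_of hQ j' in
    if (offset_of hQ j' < S u)%N then 1%N else maxn 1 (b u)./2.-1
  else 0%N.

Lemma digit_lowE u p : (p < len u)%N -> digit_low (L u + p).+1 =
  if (p < S u)%N then normal_word (a u) p else (b u - (b u)./2)%N.
Proof. by move=> pu; rewrite /digit_low offset_ofE// unit_ofE. Qed.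

Lemma digit_widthE u p : (p < len u)%N -> digit_width (L u + p).+1 =
  if (p < S u)%N then 1%N else maxn 1 (b u)./2.-1.
Proof. by move=> pu; rewrite /digit_width offset_ofE// unit_ofE. Qed.

Lemma digit_width_gt0 j : (1 <= j)%N -> (1 <= digit_width j)%N.
Proof.
case: j => // j _; have [u [p [pu ->]]] := unit_position hQ j.
by rewrite digit_widthE//; case: ifP => // _; rewrite leq_maxl.
Qed.

Lemma digit_low_width_le j : (1 <= j)%N -> (digit_low j + digit_width j <= Q j)%N.
Proof.
case: j => // j _; have [u [p [pu ->]]] := unit_position hQ j.
rewrite digit_widthE// digit_lowE// unit_digit// -/(S u) -/(a u) -/(b u).
have a0 := ltnW (a_ge2 u); have b2 := b_ge2 u.
case: ifP => _; first by rewrite addn1 normal_word_lt.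
have := odd_double_half (b u); rewrite /maxn; case: ifP => _; lia.
Qed.

Lemma digit_width_half j : (1 <= j)%N -> ((digit_width j).*2 <= (Q j).+1)%N.
Proof.
case: j => // j _; have [u [p [pu ->]]] := unit_position hQ j.
rewrite digit_widthE// unit_digit// -/(S u) -/(a u) -/(b u).
have a2 := a_ge2 u; have b2 := b_ge2 u.
case: ifP => _; first lia.
have := odd_double_half (b u); rewrite /maxn; case: ifP => _; lia.
Qed.

(** With base at least 6 the range has at least two digits and misses the top one. Such positions
    arbitrarily far out give both the admissibility of the digits and the growth of the products of
    widths. *)
Lemma beta_position m : exists u,
  [/\ (6 <= b u)%N, (m <= L u + S u)%N & (S u < len u)%N].
Proof.
have [u1 H1] := eventually_bases 6.
have [u2 H2] := @eventually_params 1 1 ltr01 isT.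
have [u3 H3] := unit_start_ge hQ m.
pose u := maxn u1 (maxn u2 u3); exists u.
have [_ b6] : (6 <= a u)%N /\ (6 <= b u)%N by apply: H1; rewrite leq_maxl.
have [_ T0 _ _] : [/\ (0 < S u)%N, (0 < T u)%N, (a u)%:R ^+ 1 <= 1 * (S u)%:R :> R &
   (T u)%:R * (a u)%:R ^+ 1 <= 1 * ((S u)%:R * (b u)%:R ^+ 1) :> R].
  by apply: H2; rewrite /u leq_max leq_maxl orbT.
split => //; last by rewrite lenE -{1}[S u]addn0 ltn_add2l.
by apply: leq_trans (leq_addr _ _); apply: H3; rewrite /u !leq_max leqnn !orbT.
Qed.

Lemma digit_low_width_lt :
  infinite_set [set j | (1 <= j)%N /\ (digit_low j + digit_width j < Q j)%N].
Proof.
apply: unbounded_infinite => m; have [u [b6 mu Su]] := beta_position m.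
exists (L u + S u).+1; first exact: leqW.
split=> //; rewrite digit_lowE// digit_widthE// ltnn Qb ?leqnn//.
by have := odd_double_half (b u); rewrite /maxn; case: ifP => _; lia.
Qed.

Lemma digit_width_unbounded (x : R) : exists n, x < qprod digit_width n.
Proof.
have pow2 k : exists n, 2 ^+ k <= qprod digit_width n :> R.
  elim: k => [|k [n IH]]; first by exists 0%N; rewrite qprod0.
  have [u [b6 nu Su]] := beta_position n; exists (L u + S u).+1.
  rewrite qprodS exprSr ler_pM//.
    apply: le_trans IH _; apply: qprod_nondecreasing => //.
    exact: digit_width_gt0.
  rewrite ler_nat digit_widthE// ltnn leq_max.
  by have := odd_double_half (b u); lia.
have [n nx] := pow2 (Num.bound `|x|); exists n; apply: lt_le_trans nx.
apply: le_lt_trans (ler_norm x) _; apply: lt_trans (archi_boundP (normr_ge0 x)) _.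
by rewrite -natrX ltr_nat ltn_expl.
Qed.

Let lnn_ge0 n : 0 <= ln (n%:R : R).
Proof. by case: n => [|n]; [rewrite ln0|rewrite ln_ge0// ler1n]. Qed.

(** From 8 on the width is at least [b / 4], and the loss [ln 4] is below [c * ln b] once [b]
    exceeds [y]. *)
Lemma digit_width_ln (c : R) : 0 < c -> exists m, forall b, (m <= b)%N ->
  (1 - c) * ln (b%:R : R) <= ln ((maxn 1 b./2.-1)%:R : R).
Proof.
move=> c0; pose y : R := expR (ln 4 / c).
exists (maxn 8 (Num.bound y)) => n; rewrite geq_max => /andP[n8 yn].
have n0 : 0 < n%:R :> R by rewrite ltr0n; lia.
have lny : ln 4 / c <= ln (n%:R : R).
  rewrite -[leLHS]expRK ler_ln ?posrE ?expR_gt0//.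
  apply: (le_trans (ler_norm _)); apply: (le_trans (ltW (archi_boundP (normr_ge0 _)))).
  by rewrite ger0_norm ?expR_ge0// ler_nat.
have w4 : n%:R / 4 <= (maxn 1 n./2.-1)%:R :> R.
  rewrite ler_pdivrMr// -natrM ler_nat.
  by have := odd_double_half n; rewrite /maxn; case: ifP => ?; lia.
apply: (@le_trans _ _ (ln (n%:R / 4))); last first.
  by rewrite ler_ln ?posrE ?divr_gt0// (lt_le_trans _ w4)// divr_gt0.
rewrite lnM ?posrE ?invr_gt0// lnV ?posrE// mulrBl mul1r lerD2l lerN2.
by rewrite -ler_pdivrMl// mulrC.
Qed.

(* The difference [phi] decreases only along the runs of alpha, by at most
   [S u * ln (a u)]; [h_log] and [h_sum] bound this by the increase along the
   next run of beta and along all the previous ones. *)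
Lemma qprod_ln_le (d : R) : 0 < d < 1 -> exists C : R, forall n,
  d * ln (qprod Q n) <= ln (qprod digit_width n) + C.
Proof.
(* With this [c], [1 - c = d + c], so every term of a late beta-run raises [phi] by at least
   [c * ln (b u)]. *)
move=> d01; pose c : R := (1 - d) / 2; have c0 : 0 < c by rewrite /c; lra.
pose phi n : R := ln (qprod digit_width n) - d * ln (qprod Q n).
have phiS n : phi n.+1 = phi n + (ln (digit_width n.+1)%:R - d * ln (Q n.+1)%:R).
  rewrite /phi !qprodS !lnM ?posrE ?ltr0n ?concat_gt0 ?digit_width_gt0//.
  - by ring.
  - exact/qprod_gt0/concat_gt0.
  - exact/qprod_gt0/digit_width_gt0.
have [m mP] := digit_width_ln c0.
have unitP u p : (m <= b u)%N -> (p <= len u)%N ->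
    phi (L u) - (minn p (S u))%:R * ln (a u)%:R + c * ((p - S u)%:R * ln (b u)%:R)
    <= phi (L u + p)%N.
  move=> mb; elim: p => [|p IH] pu.
    by rewrite min0n sub0n !mul0r mulr0 subr0 addr0 addn0.
  rewrite addnS phiS; have := IH (ltnW pu); have := lnn_ge0 (a u).
  rewrite digit_widthE//; have [pS|Sp] := ltnP p (S u).
    rewrite Qa// ln1 (minn_idPl pS).
    rewrite (eqP (ltnW pS : p - S u == 0)%N) (eqP (pS : p.+1 - S u == 0)%N).
    rewrite -[p.+1%:R]natr1 mulrDl mul1r !mul0r mulr0 !addr0.
    move: (p%:R * ln _) => A; move: (ln _) => l l0 H.
    have : d * l <= l by apply: ler_piMl => //; lra.
    by lra.
  rewrite Qb ?Sp// (minn_idPr (leqW Sp)) subSn// -[(p - S u).+1%:R]natr1.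
  rewrite [(_ + 1) * _]mulrDl mul1r mulrDr => _; move: (mP _ mb).
  have -> : 1 - c = d + c by rewrite /c; lra.
  rewrite mulrDl; move: (ln _) ((p - S u)%:R * _) => w B; lra.
have [u1 H1] := eventually_bases m.
have c20 : 0 < c / 2 by lra.
have [u2 H2] := eventually_stage (quotient_cvg0_le h_log c20).
have [u3 H3] := eventually_stage (quotient_cvg0_le h_sum c20).
pose u0 := maxn u1 (maxn u2 u3).
pose Bq u : R := \sum_(0 <= v < u) (T v)%:R * ln (b v)%:R.
have BqS u : Bq u.+1 = Bq u + (T u)%:R * ln (b u)%:R.
  by rewrite /Bq big_nat_recr.
have Tb0 v : 0 <= (T v)%:R * ln (b v)%:R :> R by rewrite mulr_ge0.
have Bq0 u : 0 <= Bq u by rewrite sumr_ge0.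
(* In a complete unit half of the gain pays for the run of alpha, by [h_log]. The other half
   accumulates in [Bq] to pay for the run of alpha of an incomplete unit. *)
have phiL u : (u0 <= u)%N -> phi (L u0) + (c / 2) * (Bq u - Bq u0) <= phi (L u).
  elim: u => [|u IH].
    by rewrite leqn0 => /eqP <-; rewrite subrr mulr0 addr0.
  rewrite leq_eqVlt => /orP[/eqP <-|]; first by rewrite subrr mulr0 addr0.
  rewrite ltnS => u0u; move: (u0u); rewrite !geq_max => /and3P[/H1[_ mb] /H2[_ Sa] _].
  have := unitP u (len u) mb (leqnn _); rewrite -LS.
  rewrite lenE (minn_idPr (leq_addr _ _)) addKn.
  move: Sa; rewrite !ger0_norm ?mulr_ge0// -/(a u) -/(b u) -/(S u) -/(T u).
  have := IH u0u; rewrite BqS.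
  by move: ((S u)%:R * _) ((T u)%:R * _) => A B; lra.
exists (`|phi (L u0)| + (c / 2) * Bq u0 + \sum_(0 <= j < L u0) `|phi j|) => n.
rewrite -lerBlDl -[leLHS]opprB lerNl -/(phi n).
have sum_ge0 : 0 <= \sum_(0 <= j < L u0) `|phi j| by rewrite sumr_ge0.
have cB : 0 <= (c / 2) * Bq u0 by rewrite mulr_ge0// ltW.
have phi0 := ler_norm (- phi (L u0)); rewrite normrN in phi0.
have [nL|Ln] := ltnP n (L u0).
  have : `|phi n| <= \sum_(0 <= j < L u0) `|phi j|.
    rewrite big_mkord (bigD1 (Ordinal nL))//= lerDl.
    by rewrite sumr_ge0.
  have := ler_norm (- phi n); rewrite normrN.
  have := normr_ge0 (phi (L u0)); lra.
have [u [p [pu nE]]] := unit_position hQ n.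
have u0u : (u0 <= u)%N.
  rewrite leqNgt; apply/negP => /(leq_unit_start hQ).
  rewrite leqNgt => /negP; apply; apply: leq_ltn_trans Ln _.
  by rewrite nE unit_startS ltn_add2l.
have := phiL _ u0u; move: (u0u); rewrite !geq_max => /and3P[/H1[_ mb] _ /H3[_ Sa]].
have := unitP u p mb (ltnW pu); rewrite -/(L u) in nE; rewrite -nE.
have : (minn p (S u))%:R * ln (a u)%:R <= (S u)%:R * ln (a u)%:R :> R.
  by rewrite ler_wpM2r// ler_nat geq_minr.
have : 0 <= c * ((p - S u)%:R * ln (b u)%:R) 
  by rewrite mulr_ge0 ?(ltW c0) ?mulr_ge0.
(* The sum in [h_sum] runs over the units of earlier stages, all of which precede [u], so it is at
   most [Bq u]. *)
have : (S u)%:R * ln (a u)%:R <= c / 2 * Bq u.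
  move: Sa; rewrite ger0_norm ?mulr_ge0// => /le_trans; apply.
  rewrite ler_pM2l// ger0_norm; last first.
    by rewrite sumr_ge0// => i _; rewrite !mulr_ge0.
  rewrite -[stage hQ u in leLHS](prednK (stage_gt0 hQ u)).
  rewrite (eq_bigr (fun i => ((t i)%:R * ln ((beta i)%:R : R)) *+ upsilon i)); last first.
    by move=> i _; rewrite -[RHS]mulr_natl mulrA.
  rewrite -(sum_stage hQ (fun i => (t i)%:R * ln ((beta i)%:R : R))).
  rewrite /Bq [leRHS](@big_cat_nat _ _ _ (units_before upsilon (stage hQ u).-1))//=.
    by rewrite lerDl sumr_ge0.
  exact: units_before_pred_stage.
rewrite mulrBr; move: (_ * ln _) (_ * ln _) (c * (_ * _)) => A A' B; lra.
Qed.

(** The products up to the place before are compared by [qprod_ln_le], at the cost of [expR C]. At a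
    place with width above 1 the base is at most 4 times the width, which gives the other factor. *)
Lemma digit_width_holder (d : R) : 0 < d < 1 -> exists2 K : R, 0 < K &
  forall n, (1 <= n)%N -> (1 < digit_width n)%N ->
    qprod Q n `^ d * (digit_width n)%:R `^ (1 - d) <= K * qprod digit_width n.
Proof.
move=> d01; have [C HC] := qprod_ln_le d01.
exists (4 * expR C); first by rewrite mulr_gt0// expR_gt0.
case=> // n _ w1.
have Pn := qprod_gt0 (R := R) n concat_gt0.
have PN := qprod_gt0 (R := R) n digit_width_gt0.
have Pd : qprod Q n `^ d <= expR C * qprod digit_width n.
  rewrite /powR gt_eqF// -[qprod digit_width n](lnK PN) -expRD ler_expR addrC.
  exact: HC.
have Qw : (Q n.+1)%:R <= 4 * (digit_width n.+1)%:R :> R.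
  move: w1; have [u [p [pu ->]]] := unit_position hQ n.
  rewrite -natrM ler_nat digit_widthE//; case: (ltnP p (S u)) => // Sp.
  rewrite Qb ?Sp//; have := odd_double_half (b u).
  by rewrite /maxn; case: ifP => ?; lia.
rewrite !qprodS; set w := (digit_width n.+1)%:R in Qw *.
have w0 : 0 < w by rewrite ltr0n digit_width_gt0.
rewrite powRM ?(ltW Pn)//.
have Qd : (Q n.+1)%:R `^ d <= 4 * w `^ d.
  apply: (@le_trans _ _ ((4 * w) `^ d)).
    by apply: ge0_ler_powR; rewrite ?nnegrE ?mulr_ge0 ?(ltW w0)//; lra.
  rewrite powRM ?(ltW w0)// ler_wpM2r ?powR_ge0//.
  by apply: ler1_powR; lra.
have wE : w `^ d * w `^ (1 - d) = w.
  rewrite -powRD; last by rewrite (gt_eqF w0)/= implybT.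
  by rewrite addrC subrK powRr1// ltW.
have -> : 4 * expR C * (qprod digit_width n * w)
    = (expR C * qprod digit_width n) * (4 * w `^ d * w `^ (1 - d)).
  by rewrite -[in LHS]wE; ring.
rewrite -mulrA ler_pM ?powR_ge0 ?mulr_ge0 ?powR_ge0//.
by rewrite ler_wpM2r ?powR_ge0.
Qed.

(** * Normality and failure of distribution normality for prescribed digits *)

Section Digits.
Variables (x : R) (E : nat -> int).
Hypothesis E_exp : is_cantor_expansion Q x E.
Hypothesis E_alpha : forall u p, (p < S u)%N ->
  E (L u + p).+1 = normal_word (a u) p.
Hypothesis E_beta : forall u p, (S u <= p < len u)%N ->
  ((b u - (b u)./2)%N : int) <= E (L u + p).+1.

Section Block.
Variables (k : nat) (B : k.-tuple nat).
Hypothesis k_gt0 : (0 < k)%N.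

Let hit j : bool := [forall i : 'I_k, E (j.+1 + i)%N == (tnth B i)%:Z].
Let weight j : R := (\prod_(j.+1 <= i < j.+1 + k) (Q i)%:R)^-1.

Let weight_ge0 j : 0 <= weight j.
Proof. by rewrite invr_ge0 (le_trans ler01)// prod_concat_ge1. Qed.

Let weight_le1 j : weight j <= 1.
Proof. by rewrite invf_le1 ?(lt_le_trans ltr01)// prod_concat_ge1. Qed.

Let prod_const u p c : (forall r, (p <= r < p + k)%N -> Q (L u + r).+1 = c) ->
  weight (L u + p) = (c%:R ^+ k)^-1.
Proof.
move=> Qc; rewrite /weight (@eq_big_nat _ _ _ _ _ _ (fun=> c%:R)); last first.
  case=> // i /andP[ji ik]; have Li : (L u <= i)%N by lia.
  by rewrite -(subnKC Li) Qc//; lia.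
by rewrite prodr_const_nat addKn.
Qed.

Let weight_alpha u p : (p + k <= S u)%N -> weight (L u + p) = ((a u)%:R ^+ k)^-1.
Proof. by move=> pk; apply: prod_const => r /andP[_ rk]; rewrite Qa//; lia. Qed.

Let weight_beta u p : (S u <= p)%N -> (p + k <= len u)%N ->
  weight (L u + p) = ((b u)%:R ^+ k)^-1.
Proof. by move=> Sp pk; apply: prod_const => r /andP[pr rk]; rewrite Qb//; lia. Qed.

Let hit_alpha u p : (p + k <= S u)%N -> hit (L u + p) = word_match B (a u) p.
Proof.
move=> pk; apply: eq_forallb => i; rewrite addSn -addnA E_alpha//.
by have := ltn_ord i; lia.
Qed.

Let Bmax : nat := \max_(i < k) tnth B i.

Let tnth_le i : (tnth B i <= Bmax)%N.
Proof. by rewrite /Bmax (bigD1 i)//= leq_maxl. Qed.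

(** Such a window contains a beta-position of unit [u]: its own start, or the first one of the run.
    The digit there is at least half of [b u], hence larger than every letter of [B]. *)
Let hit_beta u p : (Bmax.*2.+1 < b u)%N -> (S u < p + k)%N ->
  (S u < len u)%N -> (p < len u)%N -> hit (L u + p) = false.
Proof.
move=> Bb Sp Su pu; apply/negbTE/negP => /forallP hitp.
have [i pi] : exists i : 'I_k, (S u <= p + i < len u)%N.
  have [ps|Sp'] := ltnP p (S u).
    have ik : (S u - p < k)%N by lia.
    by exists (Ordinal ik); rewrite /= subnKC ?leqnn// ltnW.
  by exists (Ordinal k_gt0); rewrite /= addn0 Sp'.
have := E_beta pi; have /eqP := hitp i; rewrite addSn -addnA => ->.
rewrite lez_nat; have := tnth_le i; move: Bmax Bb => m.
by have := odd_double_half (b u); move: (tnth B i) => c; lia.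
Qed.

Let unit_hits u p : R := \sum_(0 <= r < p) (hit (L u + r))%:R.
Let unit_weight u p : R := \sum_(0 <= r < p) weight (L u + r).

(** The windows inside the run of beta have weight [(b u) ^ -k]. Those across the change of base and
    those past the end of the unit are at most [k] each, with weight at most 1. *)
Let unit_weight_tail u : (k <= S u)%N ->
  \sum_((S u).+1 - k <= r < len u) weight (L u + r)
    <= (T u)%:R / (b u)%:R ^+ k + 2 * k%:R.
Proof.
move=> kS; rewrite (@big_cat_nat _ _ _ (S u))/=; [|lia|by rewrite lenE leq_addr].
rewrite addrC mulr2n mulrDl !mul1r addrA lerD//; last first.
  apply: (@le_trans _ _ (\sum_((S u).+1 - k <= r < S u) 1)).
    by apply: ler_sum => r _; exact: weight_le1.
  by rewrite sumr_const_nat ler_nat; lia.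
apply: (@le_trans _ _ (\sum_(S u <= r < len u)
    (((b u)%:R ^+ k)^-1 + (len u < r + k)%N%:R))).
  apply: ler_sum_nat => r /andP[Sr rl]; have [rk|kr] := ltnP (len u) (r + k).
    by apply: le_trans (weight_le1 _) _; rewrite lerDr invr_ge0 exprn_ge0.
  by rewrite weight_beta// addr0.
rewrite big_split/= sumr_const_nat lenE addKn mulr_natl lerD2l -natr_sum ler_nat.
exact: sum_window_le.
Qed.

(* The [S u - k + 1] windows inside the run of alpha have the expected number of
   hits; the other windows have none, and their total weight is negligible. *)
Let eventually_discrepancy (e : R) : 0 < e -> exists u0, forall u, (u0 <= u)%N ->
  (2 * k + 2)%:R <= e * unit_weight u (len u) /\
  forall p, (p <= len u)%N ->
    `|unit_hits u p - unit_weight u p| <= e * unit_weight u p + (2 * k + 2)%:R.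
Proof.
(* [2 * d <= e] serves the discrepancy. The factor [4 * (k + 1)] serves the first claim: with
   [g >= S u / 2] windows inside the run of alpha, [(2k + 2) (a u)^k <= (2k + 2) d (S u) <= 4 (k +
   1) d g]. *)
move=> e0; pose d : R := Num.min 1 (e / (4 * (k%:R + 1))).
have k1 : 1 <= k%:R :> R by rewrite ler1n.
have k4 : 0 < 4 * (k%:R + 1) :> R by lra.
have d0 : 0 < d by rewrite lt_min ltr01 divr_gt0.
have d1 : d <= 1 by rewrite ge_min lexx.
have kde : 4 * (k%:R + 1) * d <= e.
  by rewrite mulrC -ler_pdivlMr// ge_min lexx orbT.
have de : 2 * d <= e.
  by apply: le_trans kde; rewrite ler_pM2r//; lra.
have arith m : (2 * k <= m)%N ->
  [/\ (k <= m)%N, (m.+1 - k <= m)%N & (m <= 2 * (m.+1 - k))%N].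
  by move=> ?; split; lia.
have arith_lt m r : (r < m.+1 - k)%N -> (r + k <= m)%N by lia.
have arith_ge m r : (m.+1 - k <= r)%N -> (m < r + k)%N by lia.
(* Makes [slots (a u)] large enough for the length of [B], for its code, and for [1 / d]; the last
   makes the share of the slots in a period at most [d]. *)
pose m0 := maxn k (maxn (pickle (B : seq nat)).+1 (Num.bound d^-1)).
have [u1 H1] := eventually_bases (maxn (m0.+1 ^ 3) (maxn (Bmax.*2.+2) (2 * k))).
have [u2 H2] := eventually_params d0 k_gt0.
exists (maxn u1 u2) => u; rewrite geq_max => /andP[/H1[]].
rewrite !geq_max => /and3P[am aB ak] /and3P[_ bB _] /H2[S0 T0 aS Tab].
have := le_slots am; rewrite !geq_max => /and3P[k_le code_lt dslots].
have a0 : 0 < (a u)%:R :> R by rewrite ltr0n (leq_trans _ (a_ge2 u)).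
have b0 : 0 < (b u)%:R :> R by rewrite ltr0n (leq_trans _ (b_ge2 u)).
have ak0 : 0 < (a u)%:R ^+ k :> R by rewrite exprn_gt0.
have bk0 : 0 < (b u)%:R ^+ k :> R by rewrite exprn_gt0.
have slots_small : (slots (a u) * (slots (a u)).+1)%:R <= d * (a u)%:R :> R.
  have M0 : 0 < (slots (a u)).+1%:R :> R by [].
  have dM : 1 <= d * (slots (a u)).+1%:R.
    rewrite -ler_pdivrMl// mulr1; apply: (le_trans (ler_norm _)).
    apply: (le_trans (ltW (archi_boundP (normr_ge0 _)))).
    by rewrite ger0_norm ?invr_ge0 ?(ltW d0)// ler_nat leqW.
  have M3 : (slots (a u)).+1%:R ^+ 3 <= (a u)%:R :> R.
    by rewrite -natrX ler_nat slots_le// (leq_trans _ (a_ge2 u)).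
  have M2 : (slots (a u) * (slots (a u)).+1)%:R <= (slots (a u)).+1%:R ^+ 2 :> R.
    by rewrite -natrX ler_nat expnS expn1 leq_mul2r leqnSn orbT.
  apply: (le_trans M2); apply: (@le_trans _ _ (d * (slots (a u)).+1%:R ^+ 3)).
    by rewrite [_ ^+ 3]exprS mulrA ler_peMl// exprn_ge0.
  by rewrite ler_pM2l.
have B_lt (i : 'I_k) : (tnth B i < (a u).-1)%N.
  apply: (leq_ltn_trans (tnth_le i)); rewrite ltn_predRL; apply: leq_trans aB.
  by rewrite !ltnS -addnn leq_addr.
pose g := ((S u).+1 - k)%N; pose Y n : R := n%:R / (a u)%:R ^+ k.
have Su2k : (2 * k <= S u)%N.
  apply: (leq_trans ak); rewrite -(ler_nat R).
  apply: (@le_trans _ _ ((a u)%:R ^+ k)).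
    by rewrite ler_eXnr// ler1n (ltnW (a_ge2 u)).
  by apply: (le_trans aS); rewrite ler_piMl.
have [kS gS S2g] := arith _ Su2k; rewrite -/g in gS S2g.
have SuT : (S u < len u)%N by rewrite lenE -{1}[S u]addn0 ltn_add2l.
have gl : (g <= len u)%N by exact: leq_trans gS (ltnW SuT).
pose cnt p := (\sum_(0 <= r < p) word_match B (a u) r)%N.
have cnt_ge p : Y p - 2 <= (cnt p)%:R.
  rewrite lerBlDr ler_pdivrMr// -natrX -natrD -natrM ler_nat.
  exact: sum_word_match_ge.
have cnt_le p : (cnt p)%:R <= Y p + d * Y p.
  have := sum_word_match_le k_gt0 k_le code_lt B_lt p.
  rewrite -/(cnt p) -(ler_nat R) !natrM natrX natrD exprSr => H.
  rewrite -(@ler_pM2r _ ((a u)%:R ^+ k * (a u)%:R)) ?mulr_gt0//.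
  apply: (le_trans H).
  have -> : (Y p + d * Y p) * ((a u)%:R ^+ k * (a u)%:R) = p%:R * ((a u)%:R + d * (a u)%:R).
    by rewrite /Y; field; rewrite gt_eqF.
  by rewrite ler_wpM2l// lerD2l.
have hits_small p : (p <= g)%N -> unit_hits u p = (cnt p)%:R.
  move=> pg; rewrite /unit_hits /cnt natr_sum; apply: eq_big_nat => r /andP[_ rp].
  by rewrite hit_alpha//; apply: arith_lt; exact: leq_trans rp pg.
have weight_small p : (p <= g)%N -> unit_weight u p = Y p.
  move=> pg; rewrite /unit_weight (@eq_big_nat _ _ _ _ _ _ (fun=> ((a u)%:R ^+ k)^-1)).
    by rewrite sumr_const_nat subn0 /Y mulr_natl.
  by move=> r /andP[_ rp]; rewrite weight_alpha//; apply: arith_lt; exact: leq_trans rp pg.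
have Y0 n : 0 <= Y n by rewrite divr_ge0// ltW.
have dY n : 0 <= d * Y n by rewrite mulr_ge0// ltW.
have weight_mono p q : (p <= q)%N -> unit_weight u p <= unit_weight u q.
  move=> pq; rewrite /unit_weight [leRHS](@big_cat_nat _ _ _ p)//= lerDl.
  by rewrite sumr_ge0.
have {}S2g : (S u)%:R <= 2 * g%:R :> R by rewrite -natrM ler_nat.
have tail : unit_weight u (len u) <= Y g + 2 * (d * Y g) + 2 * k%:R.
  rewrite /unit_weight (@big_cat_nat _ _ _ g)//= -/(unit_weight u g) weight_small//.
  rewrite -addrA lerD2l; apply: le_trans (unit_weight_tail kS) _; rewrite lerD2r.
  rewrite ler_pdivrMr//.
  have -> : 2 * (d * Y g) * (b u)%:R ^+ k =
      d * (2 * g%:R * (b u)%:R ^+ k) / (a u)%:R ^+ k.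
    by rewrite /Y; ring.
  rewrite ler_pdivlMr//; apply: (le_trans Tab).
  by rewrite ler_pM2l// ler_pM2r.
have natk : (2 * k + 2)%:R = 2 * k%:R + 2 :> R by rewrite natrD natrM.
split.
  apply: (@le_trans _ _ (e * Y g)); last first.
    by rewrite ler_pM2l// -weight_small// weight_mono.
  rewrite natk /Y mulrA ler_pdivlMr//.
  apply: (@le_trans _ _ ((2 * k%:R + 2) * (d * (S u)%:R))).
    by rewrite ler_pM2l//; lra.
  apply: (@le_trans _ _ ((2 * k%:R + 2) * (d * (2 * g%:R)))).
    by rewrite ler_pM2l ?ler_pM2l//; lra.
  have -> : (2 * k%:R + 2) * (d * (2 * g%:R)) = 4 * (k%:R + 1) * d * g%:R :> R by ring.
  by rewrite ler_wpM2r.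
move=> p pl; rewrite natk; have [pg|gp] := leqP p g.
  rewrite hits_small// weight_small//.
  have := cnt_ge p; have := cnt_le p; have := Y0 p; have := dY p.
  have : 2 * (d * Y p) <= e * Y p by rewrite mulrA ler_wpM2r.
  by move=> *; rewrite ler_norml; apply/andP; split; lra.
have hitsE : unit_hits u p = (cnt g)%:R.
  rewrite /unit_hits (@big_cat_nat _ _ _ g)//=; last exact: ltnW.
  rewrite -/(unit_hits u g) hits_small// big_nat big1 ?addr0// => r /andP[gr rp].
  by rewrite hit_beta//; [exact: arith_ge|exact: leq_trans rp pl].
have wg : Y g <= unit_weight u p by rewrite -weight_small// weight_mono// ltnW.
have wp : unit_weight u p <= Y g + 2 * (d * Y g) + 2 * k%:R.
  by apply: le_trans tail; exact: weight_mono.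
have := cnt_ge g; have := cnt_le g; have := Y0 g; have := dY g.
have : 2 * (d * Y g) <= e * Y g by rewrite mulrA ler_wpM2r.
have : e * Y g <= e * unit_weight u p by rewrite ler_pM2l.
by rewrite hitsE => *; rewrite ler_norml; apply/andP; split; lra.
Qed.

Let sum_unit (f : nat -> R) u p : \sum_(0 <= j < L u + p) f j =
  \sum_(0 <= j < L u) f j + \sum_(0 <= r < p) f (L u + r)%N.
Proof.
elim: p => [|p IH]; first by rewrite addn0 [X in _ + X]big_geq// addr0.
by rewrite addnS !big_nat_recr//= IH addrA.
Qed.

Let hits n : R := \sum_(0 <= j < n) (hit j)%:R.
Let weights n : R := \sum_(0 <= j < n) weight j.

(** The unit estimate is applied with [e / 2]. In a complete unit the constant [2 * k + 2] is itself
    at most [e / 2] times the weight, so constants do not add up over units; only the last,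
    incomplete unit keeps one. *)
Let hits_discrepancy (e : R) : 0 < e -> exists C, forall n,
  `|hits n - weights n| <= e * weights n + C.
Proof.
move=> e0; have e20 : 0 < e / 2 by rewrite divr_gt0.
have [u0 H0] := eventually_discrepancy e20.
have weights_ge0 n : 0 <= weights n by rewrite sumr_ge0.
have hitsL u p : hits (L u + p) = hits (L u) + unit_hits u p by exact: sum_unit.
have weightsL u p : weights (L u + p) = weights (L u) + unit_weight u p.
  exact: sum_unit.
pose C0 := \sum_(0 <= j < (L u0).+1) `|hits j - weights j|.
have C0P j : (j <= L u0)%N -> `|hits j - weights j| <= C0.
  move=> jL; rewrite /C0 big_mkord (bigD1 (Ordinal (jL : j < (L u0).+1)%N))//= lerDl.
  by rewrite sumr_ge0.
have full u : (u0 <= u)%N -> `|hits (L u) - weights (L u)| <= e * weights (L u) + C0.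
  elim: u => [|u IH].
    rewrite leqn0 => /eqP u00; apply: (le_trans (C0P _ _)); first by rewrite u00.
    by rewrite lerDr mulr_ge0// ltW.
  rewrite leq_eqVlt => /orP[/eqP <-|].
    by apply: (le_trans (C0P _ _)) => //; rewrite lerDr mulr_ge0// ltW.
  rewrite ltnS => u0u; have [Kle /(_ _ (leqnn _)) disc] := H0 _ u0u.
  rewrite LS hitsL weightsL opprD addrACA; apply: (le_trans (ler_normD _ _)).
  have := IH u0u; rewrite mulrDr; move: disc Kle.
  have -> : e / 2 * unit_weight u (len u) = (e * unit_weight u (len u)) / 2 by ring.
  by move: (e * weights _) (e * unit_weight _ _) => *; lra.
exists (C0 + (2 * k + 2)%:R) => n.
have [nL|Ln] := leqP n (L u0).
  apply: (le_trans (C0P _ nL)); have := mulr_ge0 (ltW e0) (weights_ge0 n).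
  by have := ler0n R (2 * k + 2); lra.
have [u [p [pu nE]]] := unit_position hQ n.
have u0u : (u0 <= u)%N.
  rewrite leqNgt; apply/negP => /(leq_unit_start hQ).
  rewrite leqNgt => /negP; apply; apply: leq_trans Ln _.
  by rewrite nE unit_startS ltnW// ltn_add2l.
have [_ /(_ _ (ltnW pu)) disc] := H0 _ u0u.
have := full _ u0u; rewrite nE hitsL weightsL opprD addrACA.
move=> ful; apply: (le_trans (ler_normD _ _)); move: ful disc.
have : 0 <= e * unit_weight u p by rewrite mulr_ge0 ?sumr_ge0// ltW.
have -> : e / 2 * unit_weight u p = (e * unit_weight u p) / 2 by ring.
rewrite [e * (_ + _)]mulrDr; move: (e * weights _) (e * unit_weight _ _) => *; lra.
Qed.

Let block_countE n : (block_count Q B x n)%:R = hits n.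
Proof.
rewrite /block_count /hits -natr_sum; congr (_%:R).
rewrite -sum1_count big_mkcond/=.
have -> : iota 1 n = index_iota 1 n.+1 by rewrite /index_iota subn1.
rewrite big_add1/=.
apply: eq_bigr => j _; rewrite (cantor_digitsE concat_gt0 E_exp) /hit.
by case: ifP.
Qed.

Let QsumE n : Qsum Q k n = weights n :> R.
Proof. by rewrite /Qsum /weights big_add1. Qed.

Lemma block_count_cvg : k_divergent R Q k ->
  (block_count Q B x n)%:R / Qsum Q k n @[n --> \oo] --> (1 : R).
Proof.
move=> divQ; apply/cvgrPdist_le => e e0.
have e20 : 0 < e / 2 by rewrite divr_gt0.
have [C HC] := hits_discrepancy e20.
(* Beyond this threshold [C] is at most [e / 2] times the total weight, and the [+ 1] keeps that
   weight positive. *)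
have /cvgryPge/(_ (`|C| / (e / 2) + 1)) := divQ; apply: filterS => n Wn.
rewrite block_countE QsumE; rewrite QsumE in Wn.
have CW : C <= e / 2 * weights n.
  rewrite -ler_pdivrMl// mulrC; have := ler_norm C.
  rewrite -(@ler_pM2r _ (e / 2)^-1) ?invr_gt0//; lra.
have W0 : 0 < weights n.
  by apply: lt_le_trans Wn; rewrite ltr_wpDl// divr_ge0// ltW.
have -> : 1 - hits n / weights n = (weights n - hits n) / weights n.
  by field; rewrite gt_eqF.
rewrite normrM normfV (gtr0_norm W0) ler_pdivrMr// distrC.
by have := HC n; lra.
Qed.

End Block.

Lemma digits_normal_order k : (0 < k)%N -> k_divergent R Q k -> normal_order R Q k x.
Proof. by move=> k0 divQ B; exact: block_count_cvg. Qed.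

Lemma orbit_beta u p : (S u <= p < len u)%N ->
  2^-1 <= frac_part (cantor_orbit Q (L u + p) x).
Proof.
move=> pu; rewrite frac_part_id; last exact: frac_part_itv.
apply: le_trans (cantor_orbit_ge (L u + p) concat_gt0 E_exp).
rewrite Qb// ler_pdivlMr ?ltr0n ?(leq_trans _ (b_ge2 u))// mulrC ler_pdivrMr//.
apply: (@le_trans _ _ ((b u - (b u)./2)%:R * 2)).
  by rewrite -natrM ler_nat; have := odd_double_half (b u); lia.
by rewrite ler_pM2r// -[_%:R]/((b u - (b u)./2)%N%:Z%:~R) ler_int E_beta.
Qed.

Lemma orbit_count_le u :
  (count (fun n => (0 <= frac_part (cantor_orbit Q n x) < 2^-1)%R) (iota 0 (L u))
    <= \sum_(0 <= v < u) S v)%N.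
Proof.
elim: u => [|u IH]; first by rewrite /L /unit_start big_geq.
rewrite LS iotaD count_cat big_nat_recr//= leq_add//.
rewrite add0n lenE iotaD count_cat -[leqRHS]addn0 leq_add//.
  by apply: leq_trans (count_size _ _) _; rewrite size_iota.
rewrite leqn0 -[_ == _]negbK -lt0n -has_count; apply/hasPn => j.
rewrite mem_iota -addnA => /andP[Sj jl]; have Lj : (L u <= j)%N by lia.
rewrite -(subnKC Lj) negb_and -!leNgt orbC orbit_beta//.
by rewrite lenE; lia.
Qed.

Lemma digits_not_distribution_normal : ~ distribution_normal R Q x.
Proof.
move=> /(_ 0 2^-1 (lexx _)) dn; have {}dn := dn ltac:(lra) ltac:(lra).
(* Uniform distribution would give [[0, 1/2)] a frequency of at least 1/2 - 1/8, while the density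
   hypothesis leaves at most 1/4. *)
rewrite subr0 in dn; move/cvgrPdist_le : dn => /(_ 8^-1 ltac:(lra))[n0 _ H0].
have [n1 H1] := quotient_cvg0_le h_density (ltac:(lra) : 0 < 4^-1 :> R).
have [u0 H2] := unit_start_ge hQ n0.
have [n2 /ltnW H3] := units_before_unbounded hQ u0.
(* The orbit is cut at the end of stage [n], where the sums in [h_density] are exactly the position
   and the number of alpha-positions. *)
pose n := maxn n1 n2; pose u := units_before upsilon n.
have u0u : (u0 <= u)%N.
  by apply: leq_trans H3 _; rewrite /u leq_units_before// /n leq_maxr.
have natM (c d : nat) : c *+ d = (c * d)%N.
  by elim: d => [|d IH]; rewrite ?mulr0n ?muln0// mulrS IH mulnS.
have LE : (L u)%:R = \sum_(1 <= i < n.+1)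
    (upsilon i)%:R * ((s i)%:R + (t i)%:R) :> R.
  have -> : L u = (\sum_(1 <= i < n.+1) (s i + t i) *+ upsilon i)%N.
    by rewrite -(sum_stage hQ (fun i => s i + t i)%N).
  rewrite natr_sum; apply: eq_bigr => i _.
  by rewrite natM natrM natrD mulrC.
have SE : (\sum_(0 <= v < u) S v)%N%:R =
    \sum_(1 <= i < n.+1) (upsilon i)%:R * (s i)%:R :> R.
  rewrite (sum_stage hQ s) natr_sum; apply: eq_bigr => i _.
  by rewrite natM natrM mulrC.
have [] := H1 n (leq_maxl _ _); rewrite -LE -SE !ger0_norm// => L0 SL.
have := H0 _ (H2 _ u0u); rewrite /= -/(L u) => D.
have L0' : 0 < (L u)%:R :> R by rewrite lt0r L0 ler0n.
have : (count (fun n => (0 <= frac_part (cantor_orbit Q n x) < 2^-1)%R)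
    (iota 0 (L u)))%:R / (L u)%:R <= 4^-1 :> R.
  rewrite ler_pdivrMr//; apply: le_trans SL; rewrite ler_nat.
  exact: orbit_count_le.
move: D; rewrite ler_norml => /andP[_].
by move: (_ / (L u)%:R) => y; lra.
Qed.

End Digits.

Let point : R -> R :=
  cantor_point digit_width_gt0 digit_low_width_le digit_low_width_lt.

Let choice (y : R) : nat -> int := cantor_choice digit_low digit_width y.

Let point_exp y : is_cantor_expansion Q (point y) (choice y).
Proof. exact: cantor_pointP. Qed.

Let choice_alpha y u p : (p < S u)%N -> choice y (L u + p).+1 = normal_word (a u) p.
Proof.
move=> pS; have pu : (p < len u)%N by rewrite (leq_trans pS)// leq_addr.
by rewrite /choice /cantor_choice digit_lowE// digit_widthE// pS modn1 addn0.
Qed.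

Let choice_beta y u p : (S u <= p < len u)%N ->
  ((b u - (b u)./2)%N : int) <= choice y (L u + p).+1.
Proof.
move=> /andP[Sp pu]; rewrite /choice /cantor_choice digit_lowE// ltnNge Sp/=.
by rewrite lez_nat leq_addr.
Qed.

(** The constructed points are normal of every order at which [Q] diverges, so both claims follow by
    choosing [A]. *)
Lemma hausdorff_dim_point (A : set R) :
  (forall x, (forall k, (0 < k)%N -> k_divergent R Q k -> normal_order R Q k x) ->
     ~ distribution_normal R Q x -> A x) ->
  hausdorff_dim A = 1%:E.
Proof.
move=> AP; apply/eqP; rewrite eq_le hausdorff_dim_le1/=.
apply: hausdorff_dim_ge1 => d d01; have [K K0 HK] := digit_width_holder d01.
exists (2 * 2 `^ d * K); first by rewrite !mulr_gt0// powR_gt0.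
exists point => y y01; split.
  apply: AP; last exact: (digits_not_distribution_normal (point_exp y) (@choice_beta y)).
  by move=> k; exact: (digits_normal_order (point_exp y) (@choice_alpha y) (@choice_beta y)).
move=> z z01; apply: cantor_point_holder => //; first exact: digit_width_half.
exact: digit_width_unbounded.
Qed.

End Construction.

Theorem theorem3p4 (R : realType) (alpha beta s t upsilon Q : nat -> nat)
  (h_alpha : basic_sequence alpha)
  (h_beta : basic_sequence beta)
  (hQ : is_concatenation alpha beta s t upsilon Q)
  (hQ_lim : infinite_in_limit Q)
  (h_little : (fun i => (alpha i)%:R : R^o) =o_\oo
              (fun i => (beta i)%:R : R^o))
  (h_sum : quotient_cvg0
     (fun n => (s n)%:R * ln ((alpha n)%:R : R))
     (fun n => \sum_(1 <= i < n)
        (upsilon i)%:R * (t i)%:R * ln ((beta i)%:R : R)))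
  (h_log : quotient_cvg0
     (fun n => (s n)%:R * ln ((alpha n)%:R : R))
     (fun n => (t n)%:R * ln ((beta n)%:R : R)))
  (h_pow : forall m, (1 <= m)%N -> quotient_cvg0
     (fun n => (t n)%:R * (alpha n)%:R ^+ m : R)
     (fun n => (s n)%:R * (beta n)%:R ^+ m : R))
  (h_pow_s : forall m, (1 <= m)%N -> quotient_cvg0
     (fun n => (alpha n)%:R ^+ m : R)
     (fun n => (s n)%:R : R))
  (h_density : quotient_cvg0
     (fun n => \sum_(1 <= i < n.+1) (upsilon i)%:R * (s i)%:R : R)
     (fun n => \sum_(1 <= i < n.+1)
        (upsilon i)%:R * ((s i)%:R + (t i)%:R) : R)) :
  (forall k, (1 <= k)%N -> k_divergent R Q k ->
     hausdorff_dim
       ((\bigcap_(j in [set j | (1 <= j <= k)%N]) normal_order R Q j)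
          `\` distribution_normal R Q) = 1%:E) /\
  (fully_divergent R Q ->
     hausdorff_dim (normal_set R Q `\` distribution_normal R Q) = 1%:E).
Proof.
have dim_eq1 := hausdorff_dim_point h_alpha h_beta hQ hQ_lim h_sum h_log h_pow
  h_pow_s h_density.
split=> [k k1 divk|divQ]; apply: dim_eq1 => x xnormal xDN; split=> //.
  move=> j /= /andP[j1 jk]; apply: xnormal => //.
  exact: (k_divergent_le h_alpha h_beta hQ jk).
by move=> k /= k1; apply: xnormal => //; exact: divQ.
Qed.
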